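(* For every $n\geq 5$ there exists a periodic triangulation of $\mathbb{Z}^n$ which is centrally symmetric but is not a Delaunay triangulation.
   Context: A periodic triangulation of $\mathbb{Z}^n$ is a collection $\mathcal{T}$ of $n$-dimensional simplices in $\mathbb{R}^n$ whose set of vertices is $\mathbb{Z}^n$, which cover $\mathbb{R}^n$, such that the intersection of any two simplices of $\mathcal{T}$ is a (possibly empty) face of both, and such that $\mathcal{T}+v=\mathcal{T}$ for every $v\in\mathbb{Z}^n$. It is centrally symmetric if it is invariant under $x\mapsto -x$. For a positive definite quadratic form $A$ on $\mathbb{R}^n$, the Delaunay tessellation of $\mathbb{Z}^n$ defined by $A$ is the tessellation whose tiles are the orthogonal projections to $\mathbb{R}^n$ of the facets of the convex hull of $\{(x,x^TAx) : x\in\mathbb{Z}^n\}\subset\mathbb{R}^{n+1}$. A periodic triangulation is Delaunay if it is the Delaunay tessellation defined by some positive definite quadratic form $A$. *)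

(* Defs.v *)
From mathcomp Require Import all_boot all_order all_algebra.
From mathcomp Require Import all_classical all_reals all_analysis.

Set Implicit Arguments.
Unset Strict Implicit.
Unset Printing Implicit Defensive.

Import Order.TTheory GRing.Theory Num.Theory.
Local Open Scope classical_set_scope.
Local Open Scope ring_scope.

(* Points of R^m are row vectors, and polytopes are sets of points. *)

Section ConvexGeometry.
Variables (R : realType) (m : nat).
Implicit Types (X C F S : set 'rV[R]_m) (x : 'rV[R]_m).

Definition convex_hull X : set 'rV[R]_m :=
  smallest (fun C => convex_set C) X.

Definition affinely_independent k (p : 'I_k -> 'rV[R]_m) : Prop :=
  forall w : 'I_k -> R,
    \sum_i w i = 0 -> \sum_i w i *: p i = 0 -> forall i, w i = 0.

Definition affine_dim X (d : nat) : Prop :=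
  (exists p : 'I_d.+1 -> 'rV[R]_m,
     (forall i, X (p i)) /\ affinely_independent p) /\
  ~ (exists p : 'I_d.+2 -> 'rV[R]_m,
     (forall i, X (p i)) /\ affinely_independent p).

(* The case l = 0 gives the improper faces set0 and C. *)
Definition face C F : Prop :=
  exists (l : 'cV[R]_m) (c : R),
    (forall x, C x -> (x *m l) 0 0 <= c) /\
    F = C `&` [set x | (x *m l) 0 0 = c].

Definition facet C F : Prop :=
  face C F /\ exists d, affine_dim C d.+1 /\ affine_dim F d.

(* S is the full-dimensional simplex with vertices p 0, ..., p m. *)
Definition simplex_on (p : 'I_m.+1 -> 'rV[R]_m) S : Prop :=
  affinely_independent p /\ S = convex_hull (range p).

Definition simplex S : Prop := exists p, simplex_on p S.

Definition simplex_vertex S x : Prop :=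
  exists p, simplex_on p S /\ range p x.

Definition simplex_face S F : Prop :=
  exists p (I : set 'I_m.+1), simplex_on p S /\ F = convex_hull (p @` I).

End ConvexGeometry.

Section Triangulations.
Variables (R : realType) (n : nat).
Implicit Types (T : set (set 'rV[R]_n)) (x v : 'rV[R]_n) (A : 'M[R]_n).

Definition int_point v : Prop := forall i, v 0 i \is a Num.int.

Definition translate v (S : set 'rV[R]_n) : set 'rV[R]_n :=
  [set x + v | x in S].

Definition periodic_triangulation T : Prop :=
  [/\ forall S, T S -> simplex S,
      [set x | exists S, T S /\ simplex_vertex S x] = [set x | int_point x],
      \bigcup_(S in T) S = [set: 'rV[R]_n],
      forall S S', T S -> T S' ->
        simplex_face S (S `&` S') /\ simplex_face S' (S `&` S')
    & forall v, int_point v -> [set translate v S | S in T] = T].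

Definition centrally_symmetric T : Prop :=
  [set [set - x | x in S] | S in T] = T.

Definition quad_form A x : R := (x *m A *m x^T) 0 0.

Definition positive_definite A : Prop :=
  A^T = A /\ forall x, x != 0 -> 0 < quad_form A x.

Definition lift_point A x : 'rV[R]_(n + 1) := row_mx x (quad_form A x)%:M.

Definition delaunay_tessellation A : set (set 'rV[R]_n) :=
  [set lsubmx @` F | F in
    facet (convex_hull [set lift_point A x | x in [set x | int_point x]])].

Definition delaunay_triangulation T : Prop :=
  periodic_triangulation T /\
  exists A, positive_definite A /\ T = delaunay_tessellation A.

End Triangulations.

(* Main.v *)
(* The triangulations are built by the staircase subdivision of prisms.  If the
   vertices of every simplex of a periodic triangulation of Z^m are linearly
   ordered by a translation invariant relation, then each prism S x [k, k + 1]
   is cut into the simplices spanned by the maximal chains of the product order,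
   and the product order makes the step repeatable.  The subdivision is centrally
   symmetric because reversing a chain gives a chain.

   For a form A, the diagonal d + e of the parallelogram with sides d and e can
   be an edge of the Delaunay triangulation only if A(d, e) < 0.  In a prism the
   edge d of the base, oriented upwards, produces the diagonal d + e with e the
   vertical unit vector.  Hence it suffices to find a triangulation of Z^4 whose
   order orients three edges with d1 + d2 + d3 = 0 positively, although the order
   is acyclic on every simplex.

   The Delaunay cells of the lattice D4 are cross-polytopes, of three classes
   permuted by a triality tau.  Cut each of them along one of its long diagonals,
   z to z + tau^t d, where d + tau d + tau^2 d = 0.  The short edges are oriented
   by a linear function vanishing on the three diagonals and the diagonals can
   then be oriented freely. *)

Require Import Defs.
From mathcomp Require Import all_boot all_order all_algebra.
From mathcomp Require Import all_classical all_reals all_analysis.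
From mathcomp Require Import zify ring lra.
Set Implicit Arguments.
Unset Strict Implicit.
Unset Printing Implicit Defensive.
Import Order.TTheory GRing.Theory Num.Theory.
Local Open Scope classical_set_scope.
Local Open Scope ring_scope.

(** * Convex hulls *)

Definition weights (R : realType) (I : finType) (u : I -> R) : Prop :=
  (forall i, 0 <= u i) /\ \sum_i u i = 1.

Lemma weights_le1 (R : realType) (I : finType) (u : I -> R) i :
  weights u -> u i <= 1.
Proof.
by case=> u0 <-; rewrite (bigD1 i)//= lerDl sumr_ge0.
Qed.

Section ConvexHull.
Variables (R : realType) (m : nat).
Implicit Types (C S : set 'rV[R]_m).

Lemma convex_setP C : convex_set C <->
  forall (t : R) x y, 0 <= t -> t <= 1 -> C x -> C y -> C (t *: x + (1 - t) *: y).
Proof.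
split=> [cC t x y t0 t1 Cx Cy|cC x y l /set_mem Cx /set_mem Cy].
  have := cC x y (Itv01 t0 t1) (mem_set Cx) (mem_set Cy).
  by move/set_mem.
by apply/mem_set/cC.
Qed.

(** Dividing by the total weight lets the induction pass to a tail of the list, whose weights sum to
    less than 1. Points of weight 0 may lie outside [C], as happens for weights supported on a
    face. *)
Lemma convex_set_sum C (I : eqType) (s : seq I) (u : I -> R) (p : I -> 'rV[R]_m) :
  convex_set C -> (forall i, 0 <= u i) -> (forall i, u i != 0 -> C (p i)) ->
  0 < \sum_(i <- s) u i ->
  C ((\sum_(i <- s) u i)^-1 *: \sum_(i <- s) u i *: p i).
Proof.
move=> /convex_setP cC u0 uC; elim: s => [|i s IH]; first by rewrite big_nil ltxx.
rewrite !big_cons; have [->|ui0] := eqVneq (u i) 0.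
  by rewrite scale0r !add0r.
have s0 : 0 <= \sum_(j <- s) u j by rewrite sumr_ge0.
have ui : 0 < u i by rewrite lt_neqAle eq_sym ui0 u0.
move: s0; rewrite le_eqVlt => /orP[/eqP s0 _|s0 us].
  rewrite -s0 addr0 [X in _ + X]big1_seq ?addr0 => [|j /andP[_ js]].
    by rewrite scalerA mulVf// scale1r; apply: uC.
  have := s0 => /esym/eqP; rewrite psumr_eq0// => /allP/(_ j js) /eqP ->.
  by rewrite scale0r.
have := cC (u i / (u i + \sum_(j <- s) u j)) _ _ _ _ (uC _ ui0) (IH s0).
rewrite divr_ge0 ?ler_pdivrMr ?mul1r ?lerDl ?(ltW ui) ?(ltW us) ?(ltW s0)//.
move=> /(_ isT isT); congr (C _); rewrite scalerDr !scalerA.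
congr (_ *: _ + _ *: _); first by rewrite mulrC.
by field; rewrite !gt_eqF// addr_gt0.
Qed.

Lemma convex_hull_image (I : finType) (p : I -> 'rV[R]_m) (J : set I) :
  convex_hull (p @` J) = [set x | exists u,
    [/\ weights u, forall i, ~ J i -> u i = 0 & x = \sum_i u i *: p i]].
Proof.
apply/seteqP; split=> [x|x [u [[u0 u1] uJ ->]]].
  apply; split=> /=.
    apply/convex_setP => t _ _ t0 t1 [u [[u0 u1] uJ ->]] [v [[v0 v1] vJ ->]].
    exists (fun i => t * u i + (1 - t) * v i); split.
    - split=> [i|]; first by rewrite addr_ge0// mulr_ge0 ?subr_ge0.
      by rewrite big_split/= -!mulr_sumr u1 v1 !mulr1 addrC subrK.
    - by move=> i Ji; rewrite uJ// vJ// !mulr0 addr0.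
    - rewrite !scaler_sumr -big_split/=; apply: eq_bigr => i _.
      by rewrite !scalerA -scalerDl.
  move=> _ [i Ji <-]; exists (fun j => (j == i)%:R); split.
  - split=> [j|]; first by rewrite ler0n.
    by rewrite (bigD1 i)//= eqxx big1 ?addr0// => j /negPf ->.
  - by move=> j Jj; case: eqVneq => [ji|//]; rewrite ji in Jj.
  - rewrite (bigD1 i)//= eqxx scale1r big1 ?addr0// => j /negPf ->.
    by rewrite scale0r.
move=> C [/= cC pC].
have := @convex_set_sum C _ (index_enum I) u p cC u0.
rewrite u1 invr1 scale1r; apply=> // i ui; apply: pC; exists i => //.
by apply: contrapT => /uJ /eqP; apply/negP.
Qed.

Lemma convex_hull_range (I : finType) (p : I -> 'rV[R]_m) :
  convex_hull (range p) = [set x | exists u,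
    weights u /\ x = \sum_i u i *: p i].
Proof.
rewrite convex_hull_image; apply/seteqP; split=> x [u].
  by case=> wu _ xu; exists u.
by case=> wu xu; exists u; split=> // i [].
Qed.

Lemma convex_hull_vertex (I : finType) (p : I -> 'rV[R]_m) i :
  convex_hull (range p) (p i).
Proof. by move=> C [_]; apply; exists i. Qed.

(** [simplex_vertex] allows any vertex list of a simplex, so two lists must be compared. Writing
    [q j] through the [p i] and each [p i] through the [q k] gives a relation among the [q k];
    affine independence then makes every [p i] of nonzero weight equal to [q j]. *)
Lemma simplex_on_vertices (p q : 'I_m.+1 -> 'rV[R]_m) S :
  simplex_on p S -> simplex_on q S -> range q `<=` range p.
Proof.
move=> [_ Sp] [qi Sq] _ [j _ <-].
have : S (q j) by rewrite Sq; exact: convex_hull_vertex.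
rewrite {1}Sp convex_hull_range => -[u [[u0 u1] qju]].
have /choice[M MP] : forall i, exists w, weights w /\ p i = \sum_k w k *: q k.
  move=> i; have : S (p i) by rewrite Sp; exact: convex_hull_vertex.
  by rewrite Sq convex_hull_range.
have qj : \sum_k (\sum_i u i * M i k) *: q k = q j.
  rewrite [RHS]qju; under [RHS]eq_bigr do rewrite (MP _).2 scaler_sumr.
  rewrite exchange_big/=; apply: eq_bigr => k _; rewrite scaler_suml.
  by apply: eq_bigr => i _; rewrite scalerA.
have sM : \sum_k \sum_i u i * M i k = 1.
  rewrite exchange_big/= -[RHS]u1; apply: eq_bigr => i _.
  by rewrite -mulr_sumr (MP _).1.2 mulr1.
have Mj : \sum_i u i * M i j = 1.
  have /(_ _ _ j) := qi (fun k => \sum_i u i * M i k - (k == j)%:R).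
  rewrite eqxx => /(_ _ _)/eqP; rewrite subr_eq0 => H; apply/eqP/H.
    rewrite big_split/= sM sumrN (bigD1 j)//= eqxx big1 ?addr0 ?subrr//.
    by move=> k /negPf ->.
  under eq_bigr do rewrite scalerBl.
  rewrite big_split/= qj sumrN (bigD1 j)//= eqxx scale1r big1 ?addr0 ?subrr//.
  by move=> k /negPf ->; rewrite scale0r.
have [i ui] : exists i, u i != 0.
  apply: contrapT => /forallNP ui; have := u1; rewrite big1.
    by move/eqP; rewrite eq_sym oner_eq0.
  by move=> i _; apply/eqP; apply: contrapT => /negP /ui.
exists i => //.
(* The numbers [M i j] are at most 1 and their average with weights [u] is 1, so they equal 1
   wherever [u i] is nonzero. *)
have Mij : M i j = 1.
  have : \sum_i u i * (1 - M i j) = 0.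
    under eq_bigr do rewrite mulrBr mulr1.
    by rewrite big_split/= u1 sumrN Mj subrr.
  have H k : 0 <= u k * (1 - M k j).
    by rewrite mulr_ge0// subr_ge0; apply: weights_le1 (MP k).1.
  move/eqP; rewrite psumr_eq0// => /allP/(_ i (mem_index_enum _)).
  by rewrite /= mulf_eq0 (negPf ui)/= subr_eq0 => /eqP.
rewrite (MP i).2 (bigD1 j)//= Mij scale1r big1 ?addr0// => k kj.
have [M0 M1] := (MP i).1; move: M1; rewrite (bigD1 j)//= Mij.
move/eqP; rewrite -subr_eq0 addrAC subrr add0r psumr_eq0// => /allP.
move=> /(_ k (mem_index_enum _)); rewrite kj/= => /eqP ->.
by rewrite scale0r.
Qed.

End ConvexHull.

(** * Ordered periodic triangulations *)

Section OrderedTriangulation.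
Variable R : realType.

Definition real_point m (v : 'rV[int]_m) : 'rV[R]_m := map_mx intr v.
Arguments real_point {m} v.

Definition barycenter m (I : finType) (u : I -> R) (p : I -> 'rV[int]_m) :=
  \sum_i u i *: real_point (p i).

(** Barycentric coordinates indexed by lattice points instead of positions, so that different vertex
    lists, even with repetitions, can be compared. In this form [ot_uniq] yields both affine
    independence and face-to-face intersection. *)
Definition mass m (I : finType) (u : I -> R) (p : I -> 'rV[int]_m) v : R :=
  \sum_(i | p i == v) u i.

(* [Sg] is the set of simplices, given by their vertices in increasing order
   for the relation "[P (w - v)]", which need not be transitive. *)
Record ordered_triangulation m (Sg : set ('I_m.+1 -> 'rV[int]_m))
    (P : set 'rV[int]_m) : Prop := OrderedTriangulation {
  ot_chain : forall p, Sg p -> forall i j : 'I_m.+1, (i < j)%N -> P (p j - p i);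
  ot_asym : forall v, P v -> ~ P (- v);
  ot_shift : forall p v, Sg p -> Sg (fun i => p i + v);
  ot_opp : forall p, Sg p -> Sg (fun i => - p (rev_ord i));
  ot_cover : forall x : 'rV[R]_m, exists p u, [/\ Sg p, weights u & x = barycenter u p];
  ot_uniq : forall p p' (u u' : 'I_m.+1 -> R), Sg p -> Sg p' -> weights u -> weights u' ->
    barycenter u p = barycenter u' p' -> mass u p =1 mass u' p' }.

Definition simplices m (Sg : set ('I_m.+1 -> 'rV[int]_m)) :
    set (set 'rV[R]_m) :=
  [set S | exists2 p, Sg p & S = convex_hull (range (real_point \o p))].

Lemma real_pointD m (v w : 'rV[int]_m) :
  real_point (v + w) = real_point v + real_point w.
Proof. exact: map_mxD. Qed.

Lemma real_pointN m (v : 'rV[int]_m) : real_point (- v) = - real_point v.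
Proof. exact: map_mxN. Qed.

Lemma real_point_inj m : injective (@real_point m).
Proof.
move=> v w /rowP vw; apply/rowP => i; have := vw i.
by rewrite !mxE => /intr_inj.
Qed.

Lemma int_pointP m (x : 'rV[R]_m) :
  int_point x <-> exists v : 'rV[int]_m, x = real_point v.
Proof.
split=> [xi|[v ->] i]; last by rewrite mxE intr_int.
exists (\row_i Num.floor (x 0 i)); apply/rowP => i; rewrite !mxE.
by rewrite floorK.
Qed.

Lemma mass_inj m (I : finType) (u : I -> R) (p : I -> 'rV[int]_m) i :
  injective p -> mass u p (p i) = u i.
Proof.
move=> pI; rewrite /mass (bigD1 i)//= big1 ?addr0// => j /andP[/eqP/pI->].
by rewrite eqxx.
Qed.

Lemma mass_gt0 m (I : finType) (u : I -> R) (p : I -> 'rV[int]_m) i :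
  weights u -> 0 < u i -> 0 < mass u p (p i).
Proof.
move=> [u0 _] ui; rewrite /mass (bigD1 i)//= ltr_wpDr//.
by rewrite sumr_ge0.
Qed.

Lemma mass_neq0 m (I : finType) (u : I -> R) (p : I -> 'rV[int]_m) v :
  mass u p v != 0 -> exists2 i, p i = v & u i != 0.
Proof.
apply: contra_neqP => nv; apply: big1 => i /eqP iv; apply/eqP.
by apply: contrapT => /negP ui; apply: nv; exists i.
Qed.

(** The cases [a = 1] and [a = -1] serve translations and the central symmetry. *)
Lemma convex_hull_homothety m (I : finType) (p : I -> 'rV[R]_m) (a : R) v :
  convex_hull (range (fun i => a *: p i + v)) =
  [set a *: x + v | x in convex_hull (range p)].
Proof.
have E (u : I -> R) : weights u ->
    \sum_i u i *: (a *: p i + v) = a *: (\sum_i u i *: p i) + v.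
  case=> _ u1; under eq_bigr do rewrite scalerDr.
  rewrite big_split/= -scaler_suml u1 scale1r; congr (_ + _).
  by rewrite scaler_sumr; apply: eq_bigr => i _; rewrite !scalerA mulrC.
rewrite !convex_hull_range; apply/seteqP; split=> [x [u [wu ->]]|_ [_ [u [wu ->]] <-]].
  by exists (\sum_i u i *: p i); [exists u|rewrite E].
by exists u; rewrite E.
Qed.

(** * From ordered triangulations to symmetric periodic triangulations *)

Section Theory.
Variables (m : nat) (Sg : set ('I_m.+1 -> 'rV[int]_m)) (P : set 'rV[int]_m).
Hypothesis otP : ordered_triangulation Sg P.

Lemma ot_inj p : Sg p -> injective p.
Proof.
have P0 : ~ P 0 by move=> P0; have := ot_asym otP P0; rewrite oppr0; apply.
move=> Sp i j pij; have [ij|ij|/val_inj//] := ltngtP i j.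
- by have := ot_chain otP Sp ij; rewrite pij subrr.
- by have := ot_chain otP Sp ij; rewrite pij subrr.
Qed.

(** An affine relation [w] perturbs the uniform weights to other weights with the same barycenter,
    and uniqueness forces [w] to vanish. *)
Lemma ot_affinely_independent p :
  Sg p -> affinely_independent (real_point \o p).
Proof.
move=> Sp w w0 wp i.
(* Small enough that [e] times the absolute value of [w j] is at most 1 / (m + 1), which keeps the
   perturbed weights nonnegative. *)
pose e : R := (m.+1%:R * (1 + \sum_j `|w j|))^-1.
have W0 : 0 < 1 + \sum_j `|w j| by rewrite ltr_pwDl// sumr_ge0.
have e0 : 0 < e by rewrite invr_gt0 mulr_gt0.
pose u (j : 'I_m.+1) : R := m.+1%:R^-1.
have u1 : \sum_j u j = 1.
  by rewrite sumr_const card_ord -[LHS]mulr_natl divff ?pnatr_eq0.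
have wu : weights u by split=> // j; rewrite invr_ge0.
have wu' : weights (fun j => u j + e * w j).
  split=> [j|]; last by rewrite big_split/= u1 -mulr_sumr w0 mulr0 addr0.
  rewrite -lerBlDl sub0r lerNl -mulrN (le_trans (ler_norm _))//.
  rewrite normrM normrN gtr0_norm// /e /u invfM -mulrA ler_piMr ?invr_ge0//.
  rewrite ler_pdivrMl// mulr1 (bigD1 j)//= addrCA lerDl.
  by rewrite addr_ge0 ?sumr_ge0.
have := ot_uniq otP Sp Sp wu wu' _ (p i).
rewrite !mass_inj; try exact: ot_inj.
move=> /(_ _)/eqP; rewrite -subr_eq0 opprD addrA subrr add0r oppr_eq0.
rewrite mulf_eq0 (gt_eqF e0)/= => H; apply/eqP/H.
rewrite /barycenter; under [RHS]eq_bigr do rewrite scalerDl -scalerA.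
by rewrite big_split/= -[X in _ + X]scaler_sumr [X in e *: X]wp scaler0 addr0.
Qed.

Lemma ot_simplex p :
  Sg p -> simplex_on (real_point \o p) (convex_hull (range (real_point \o p))).
Proof. by move=> Sp; split=> //; exact: ot_affinely_independent. Qed.

(** A common point has equal masses in both simplices, so only shared vertices carry weight. *)
Lemma ot_simplex_face p p' : Sg p -> Sg p' ->
  simplex_face (convex_hull (range (real_point \o p)))
    (convex_hull (range (real_point \o p)) `&`
     convex_hull (range (real_point \o p'))).
Proof.
move=> Sp Sp'; exists (real_point \o p), [set i | range p' (p i)].
split; first exact: ot_simplex.
rewrite [RHS]convex_hull_image; apply/seteqP; split=> x.
  rewrite !convex_hull_range => -[[u [wu xu]] [u' [wu' xu']]].
  exists u; split=> // i /= pi; apply/eqP; apply: contrapT => /negP ui.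
  have ui0 : 0 < u i by rewrite lt_neqAle eq_sym ui wu.1.
  have := mass_gt0 p wu ui0; rewrite (ot_uniq otP Sp Sp' wu wu' (etrans (esym xu) xu')).
  by rewrite lt_neqAle eq_sym => /andP[/mass_neq0[j pj _] _]; apply: pi; exists j.
move=> [u [wu uJ xu]]; split; first by rewrite convex_hull_range; exists u.
move=> C [cC p'C]; rewrite xu.
have := @convex_set_sum R m C _ (index_enum _) u (real_point \o p) cC wu.1.
rewrite wu.2 invr1 scale1r; apply=> // i ui; apply: p'C.
have [j _ pj] : range p' (p i).
  by apply: contrapT => /uJ /eqP; apply/negP.
by exists j => //=; rewrite pj.
Qed.

Lemma ot_vertex v : exists2 p, Sg p & exists i, p i = v.
Proof.
have [p [u [Sp _ _]]] := ot_cover otP 0.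
exists (fun i => p i + (v - p ord0)); first exact: (ot_shift otP).
by exists ord0; rewrite addrC subrK.
Qed.

(** By translation [v] is a vertex of some simplex, where it has mass 1; by uniqueness it has mass 1
    in [p] as well. *)
Lemma ot_int_point p v : Sg p ->
  convex_hull (range (real_point \o p)) (real_point v) -> range p v.
Proof.
move=> Sp; rewrite convex_hull_range => -[u [wu vu]].
have [p' Sp' [i pi]] := ot_vertex v.
have wi : weights (fun j => (j == i)%:R : R).
  split=> [j|]; first by rewrite ler0n.
  by rewrite (bigD1 i)//= eqxx big1 ?addr0// => j /negPf ->.
have vi : barycenter (fun j => (j == i)%:R) p' = real_point v.
  rewrite /barycenter (bigD1 i)//= eqxx scale1r pi big1 ?addr0// => j /negPf ->.
  by rewrite scale0r.
have := ot_uniq otP Sp' Sp wi wu; rewrite vi => /(_ vu v).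
rewrite -pi mass_inj; last exact: ot_inj.
rewrite eqxx => /esym/eqP m1.
have /mass_neq0[j pj _] : mass u p (p' i) != 0 by rewrite (eqP m1) oner_eq0.
by exists j.
Qed.

Lemma ot_periodic_triangulation : periodic_triangulation (simplices Sg).
Proof.
split.
- by move=> _ [p Sp ->]; exists (real_point \o p); exact: ot_simplex.
- apply/seteqP; split=> x /=.
    move=> [_ [[p Sp ->] [q [qS qx]]]]; apply/int_pointP.
    have [i _ <-] := simplex_on_vertices (ot_simplex Sp) qS qx.
    by exists (p i).
  move/int_pointP => [v ->]; have [p Sp [i pi]] := ot_vertex v.
  exists (convex_hull (range (real_point \o p))); split; first by exists p.
  exists (real_point \o p); split; first exact: ot_simplex.
  by exists i => //=; rewrite pi.
- apply/seteqP; split=> // x _.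
  have [p [u [Sp wu xu]]] := ot_cover otP x.
  exists (convex_hull (range (real_point \o p))); first by exists p.
  by rewrite convex_hull_range; exists u.
- move=> _ _ [p Sp ->] [p' Sp' ->]; split; first exact: ot_simplex_face.
  by rewrite setIC; exact: ot_simplex_face.
- have tr p v : translate (real_point v) (convex_hull (range (real_point \o p)))
      = convex_hull (range (real_point \o fun i : 'I_m.+1 => p i + v)).
    have -> : real_point \o (fun i => p i + v) =
        fun i : 'I_m.+1 => 1 *: real_point (p i) + real_point v.
      by apply/funext => i /=; rewrite real_pointD scale1r.
    rewrite convex_hull_homothety /translate; congr image.
    by apply/funext => x; rewrite scale1r.
  move=> _ /int_pointP[v ->]; apply/seteqP; split=> S.
    by move=> [_ [p Sp ->] <-]; exists (fun i => p i + v); [exact: (ot_shift otP)|].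
  move=> [p Sp ->]; exists (convex_hull (range (real_point \o fun i : 'I_m.+1 => p i - v))).
    exact: ex_intro2 (ot_shift otP (- v) Sp) erefl.
  rewrite tr (_ : (fun i => _) = p)//; apply/funext => i; exact: subrK.
Qed.

Lemma ot_centrally_symmetric : centrally_symmetric (simplices Sg).
Proof.
have sym p : [set - x | x in convex_hull (range (real_point \o p))]
    = convex_hull (range (real_point \o (fun i : 'I_m.+1 => - p (rev_ord i)))).
  have -> : range (real_point \o (fun i : 'I_m.+1 => - p (rev_ord i))) =
      range (fun i : 'I_m.+1 => -1 *: real_point (p i) + 0).
    apply/seteqP; split=> _ [i _ <-]; exists (rev_ord i) => //=.
      by rewrite real_pointN scaleN1r addr0.
    by rewrite rev_ordK real_pointN scaleN1r addr0.
  rewrite convex_hull_homothety; congr image.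
  by apply/funext => x; rewrite scaleN1r addr0.
apply/seteqP; split=> S.
  by move=> [_ [p Sp ->] <-]; exists (fun i => - p (rev_ord i)); [exact: (ot_opp otP)|exact: sym].
move=> [p Sp ->]; exists (convex_hull (range (real_point \o (fun i : 'I_m.+1 => - p (rev_ord i))))).
  exact: ex_intro2 (ot_opp otP Sp) erefl.
rewrite sym (_ : (fun i => _) = p)//; apply/funext => i.
by rewrite opprK rev_ordK.
Qed.

End Theory.
End OrderedTriangulation.
Arguments real_point R {m} v.
Arguments simplices R {m} Sg _.

(** * Subdivision of prisms *)

Section RowCons.
Variables (V : Type) (m : nat).

Definition row_cons (c : V) (v : 'rV[V]_m) : 'rV[V]_m.+1 :=
  \row_i (if unlift ord0 i is Some j then v 0 j else c).

Definition row_tail (w : 'rV[V]_m.+1) : 'rV[V]_m := \row_j w 0 (lift ord0 j).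

Lemma row_consK c v : row_tail (row_cons c v) = v.
Proof. by apply/rowP => j; rewrite !mxE liftK. Qed.

Lemma row_cons0 c v : row_cons c v 0 0 = c.
Proof. by rewrite mxE unlift_none. Qed.

Lemma row_cons_tail (w : 'rV[V]_m.+1) : row_cons (w 0 0) (row_tail w) = w.
Proof.
by apply/rowP => i; rewrite mxE; case: unliftP => [j ->|->//]; rewrite mxE.
Qed.

Lemma row_consP (w w' : 'rV[V]_m.+1) :
  w 0 0 = w' 0 0 -> row_tail w = row_tail w' -> w = w'.
Proof. by rewrite -{3}(row_cons_tail w) -{3}(row_cons_tail w') => -> ->. Qed.

End RowCons.
Arguments row_tail {V m} w.

Lemma row_tailD (V : nmodType) m (w w' : 'rV[V]_m.+1) :
  row_tail (w + w') = row_tail w + row_tail w'.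
Proof. by apply/rowP => j; rewrite !mxE. Qed.

Lemma row_tailN (V : zmodType) m (w : 'rV[V]_m.+1) :
  row_tail (- w) = - row_tail w.
Proof. by apply/rowP => j; rewrite !mxE. Qed.

Section WeightSums.
Variable R : realType.

Lemma mass_eq_sum m (I I' : finType) (p : I -> 'rV[int]_m) (p' : I' -> 'rV[int]_m)
    (u : I -> R) (u' : I' -> R) (E : pred 'rV[int]_m) :
  mass u p =1 mass u' p' -> \sum_(i | E (p i)) u i = \sum_(i | E (p' i)) u' i.
Proof.
pose r := undup (codom p ++ codom p').
have H (J : finType) (q : J -> 'rV[int]_m) (w : J -> R) :
    (forall j, q j \in r) ->
    \sum_(j | E (q j)) w j = \sum_(v <- r | E v) mass w q v.
  move=> qr; rewrite (exchange_big_dep xpredT)//= big_mkcond/=.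
  apply: eq_bigr => j _; rewrite big_mkcond (bigD1_seq (q j)) ?undup_uniq//=.
  rewrite eqxx andbT big1 ?addr0// => v /negPf; rewrite eq_sym => ->.
  by rewrite andbF.
move=> uu'; rewrite !H; first by apply: eq_bigr => v _; exact: uu'.
  by move=> j; rewrite mem_undup mem_cat codom_f orbT.
by move=> j; rewrite mem_undup mem_cat codom_f.
Qed.

(** The second hypothesis says that if [E] is not inside [C] then [C] is inside [E]; the
    intersection is the smaller of two nested sets. *)
Lemma sum_nested (I : finType) (u : I -> R) (E C : pred I) :
  (forall i, 0 <= u i) ->
  (forall i j, E i -> ~~ C i -> C j -> E j) ->
  \sum_(i | E i && C i) u i = Num.min (\sum_(i | E i) u i) (\sum_(i | C i) u i).
Proof.
move=> u0 EC.
have le (A B : pred I) : subpred A B -> \sum_(i | A i) u i <= \sum_(i | B i) u i.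
  move=> AB; rewrite big_mkcond [leRHS]big_mkcond; apply: ler_sum => i _.
  by case: ifP => [/AB->//|_]; case: ifP.
have [i /andP[Ei Ci]|nEC] := pickP [pred i | E i && ~~ C i].
  rewrite min_r; last by apply: le => j; exact: EC Ei Ci.
  by apply: eq_bigl => j; apply: andb_idl; exact: EC Ei Ci.
have EsC i : E i -> C i by move=> Ei; have := nEC i; rewrite /= Ei => /negbFE.
rewrite min_l; last exact: le.
by apply: eq_bigl => j; apply: andb_idr => /EsC.
Qed.

Lemma tail_barycenter m (I : finType) (u : I -> R) (p : I -> 'rV[int]_m.+1) :
  row_tail (barycenter u p) = barycenter u (row_tail \o p).
Proof.
apply/rowP => j; rewrite mxE !summxE; apply: eq_bigr => i _.
by rewrite !mxE.
Qed.

Lemma head_barycenter m (I : finType) (u : I -> R) (p : I -> 'rV[int]_m.+1) :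
  barycenter u p 0 0 = \sum_i u i * (p i 0 0)%:~R.
Proof. by rewrite summxE; apply: eq_bigr => i _; rewrite !mxE. Qed.

End WeightSums.

Section Prism.
Variables (R : realType) (m : nat).
Variables (Sg : set ('I_m.+1 -> 'rV[int]_m)) (P : set 'rV[int]_m).

Definition prism_order : set 'rV[int]_m.+1 :=
  [set w | [/\ w <> 0, row_tail w = 0 \/ P (row_tail w) & 0 <= w 0 0]].

(** Since [prism_order] excludes 0, the entries of [q] are distinct, and m + 2 is the length of a
    maximal chain in the product of m + 1 ordered vertices with {k, k + 1}. *)
Definition prism_simplices : set ('I_m.+2 -> 'rV[int]_m.+1) :=
  [set q | (forall i j : 'I_m.+2, (i < j)%N -> prism_order (q j - q i)) /\
    exists p (k : int), Sg p /\ forall j,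
      range p (row_tail (q j)) /\ (q j 0 0 = k \/ q j 0 0 = k + 1)].

(** The chain follows the bottom copy of [p] up to [p i], rises there, and continues in the top
    copy. Position [i] holds the bottom copy of [p i], position [i + 1] the top one. *)
Definition staircase (p : 'I_m.+1 -> 'rV[int]_m) (k : int) (i : 'I_m.+1)
    (j : 'I_m.+2) : 'rV[int]_m.+1 :=
  if unlift (widen_ord (leqnSn _) i) j is Some l
  then row_cons (k + (i <= l)%N%:R) (p l) else row_cons k (p i).

Hypothesis otP : ordered_triangulation R Sg P.

Lemma staircase_simplex p k i : Sg p -> prism_simplices (staircase p k i).
Proof.
move=> Sp; split; last first.
  exists p, k; split=> // j; rewrite /staircase; case: unliftP => [l _|_].
    rewrite row_consK row_cons0; split; first by exists l.
    by case: leqP => _; [right|left; rewrite addr0].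
  by rewrite row_consK row_cons0; split; [exists i|left].
have cons0 (c c' : int) (v v' : 'rV[int]_m) :
    (row_cons c v - row_cons c' v') 0 0 = c - c'.
  by rewrite !mxE unlift_none.
have consK (c c' : int) (v v' : 'rV[int]_m) :
    row_tail (row_cons c v - row_cons c' v') = v - v'.
  by rewrite row_tailD row_tailN !row_consK.
have P0 : ~ P 0 by move=> P0; have := ot_asym otP P0; rewrite oppr0; apply.
have aux c c' (l l' : 'I_m.+1) : 0 <= c - c' -> (l' < l)%N || (l' == l) && (c != c') ->
    prism_order (row_cons c (p l) - row_cons c' (p l')).
  move=> cc' H; split; last by rewrite cons0.
    move/eqP: H => H w0; move: H.
    have := cons0 c c' (p l) (p l'); rewrite w0 mxE => /esym/subr0_eq ->.
    rewrite eqxx andbF orbF => /eqP ll'.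
    have := consK c c' (p l) (p l'); rewrite w0 => pp; apply: P0.
    have := ot_chain otP Sp ll'; rewrite -pp; congr (P _).
    by apply/rowP => j; rewrite !mxE.
  rewrite consK; case/orP: H => [ll'|/andP[/eqP -> _]]; last by left; rewrite subrr.
  by right; exact: (ot_chain otP Sp ll').
move=> j j'; rewrite /staircase.
case: unliftP => [l ->|->]; case: unliftP => [l' ->|->]; rewrite /= /bump => jj';
  apply: aux; rewrite ?eqxx; do ?[move: jj'; case: leqP];
  try lia.
move=> + _; case: (ltngtP (i : nat) l) => [//|il|/val_inj <-].
  by rewrite add0n ltnNge (ltnW il).
by move=> _; rewrite eqxx -subr_eq0 addrAC subrr.
Qed.

(** The vertical line over a point of the base crosses the staircases in turn: at relative height
    [s] the vertices after [p i] are on top, those before it at the bottom, and the weight of [p i]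
    is shared. *)
Lemma prism_cover (x : 'rV[R]_m.+1) : exists q u,
  [/\ prism_simplices q, weights u & x = barycenter u q].
Proof.
have [p [u [Sp wu xu]]] := ot_cover otP (row_tail x).
pose k := Num.floor (x 0 0); pose s : R := x 0 0 - k%:~R.
have s0 : 0 <= s by rewrite subr_ge0 ge_floor.
have s1 : s <= 1 by rewrite lerBlDl -[1]/(1%:~R) -intrD ltW// lt_succ_floor.
pose A n := \sum_(l < m.+1 | (n < l)%N) u l.
have exA : exists n, A n <= s.
  exists m; rewrite /A big_pred0// => l; apply/negbTE; rewrite -leqNgt.
  exact: ltn_ord l.
(* The rise is at the first index whose later weights sum to at most [s]; minimality gives
   [b <= u i]. *)
have [n An nmin] := ex_minnP exA.
have nm : (n < m.+1)%N.
  rewrite ltnS; apply: nmin; rewrite /A big_pred0// => l; apply/negbTE.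
  by rewrite -leqNgt; exact: ltn_ord l.
pose i := Ordinal nm; pose b := s - A n.
have b0 : 0 <= b by rewrite subr_ge0.
have uA : b <= u i.
  rewrite lerBlDr (_ : _ + _ = \sum_(l < m.+1 | (n <= l)%N) u l); last first.
    rewrite [RHS](bigD1 i)//=; congr (_ + _); apply: eq_bigl => l.
    by rewrite ltn_neqAle eq_sym andbC -val_eqE.
  case: (posnP n) => [->|n0]; first by rewrite wu.2.
  apply/ltW; rewrite ltNge; apply/negP => H.
  have /nmin : A n.-1 <= s.
    by rewrite /A (eq_bigl (fun l : 'I_m.+1 => (n <= l)%N))// => l; rewrite prednK.
  by rewrite leqNgt prednK// leqnn.
pose j0 := widen_ord (leqnSn m.+1) i.
(* The top copy of [p i] gets [b] and its bottom copy gets [u i - b]. *)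
pose w j := if unlift j0 j is Some l then (if l == i then b else u l) else u i - b.
have sumw (V : nmodType) (F : 'I_m.+2 -> V) : \sum_j F j = F j0 + \sum_l F (lift j0 l).
  by rewrite (bigD1_ord j0).
exists (staircase p k i), w; split; first exact: staircase_simplex.
- split=> [j|].
    rewrite /w; case: unliftP => [l _|_]; last by rewrite subr_ge0.
    by case: ifP => // _; exact: wu.1.
  rewrite sumw /w unlift_none; under eq_bigr do rewrite liftK.
  rewrite (bigD1 i)//= eqxx addrA subrK -[RHS]wu.2 [RHS](bigD1 i)//=.
  by congr (_ + _); apply: eq_bigr => l /negPf ->.
- apply: row_consP.
    rewrite head_barycenter sumw /w /staircase unlift_none row_cons0.
    under eq_bigr do rewrite liftK row_cons0.
    rewrite (bigD1 i)//= eqxx leqnn (bigID (fun l : 'I_m.+1 => n < l)%N)/=.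
    have -> : \sum_(l < m.+1 | (l != i) && (n < l)%N)
        (if l == i then b else u l) * (k + (n <= l)%N%:R)%:~R = A n * (k + 1)%:~R.
      rewrite /A mulr_suml; apply: eq_big => [l|l /andP[/negPf -> /ltnW ->]//].
      by case: ltnP; rewrite ?andbF// andbT -val_eqE /= neq_ltn orbC => ->.
    have -> : \sum_(l < m.+1 | (l != i) && ~~ (n < l)%N)
        (if l == i then b else u l) * (k + (n <= l)%N%:R)%:~R =
        (1 - u i - A n) * k%:~R.
      have -> : 1 - u i - A n = \sum_(l < m.+1 | (l != i) && ~~ (n < l)%N) u l.
        rewrite -wu.2 (bigD1 i)//= [u i + _]addrC addrK.
        rewrite (bigID (fun l : 'I_m.+1 => n < l)%N)/=.
        rewrite (_ : \sum_(l | _ && _) _ = A n) ?[A n + _]addrC ?addrK//.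
        apply: eq_bigl => l.
        by case: ltnP; rewrite ?andbF// andbT -val_eqE /= neq_ltn orbC => ->.
      rewrite mulr_suml; apply: eq_bigr => l /andP[/[dup] + /negPf -> nl].
      rewrite -val_eqE /= => ln; rewrite (_ : (n <= l)%N = false) ?addr0//.
      by move: ln nl; rewrite -leqNgt; case: ltngtP.
    rewrite /b intrD /s; ring.
  rewrite tail_barycenter xu /barycenter sumw /w /staircase /= unlift_none row_consK.
  under [X in _ = _ + X]eq_bigr do rewrite liftK row_consK.
  rewrite [RHS](_ : _ = (u i - b) *: real_point R (p i) + (b *: real_point R (p i)
    + \sum_(l | l != i) u l *: real_point R (p l))).
    by rewrite addrA -scalerDl subrK (bigD1 i).
  rewrite (bigD1 i)//= eqxx; congr (_ + (_ + _)).
  by apply: eq_bigr => l /negPf ->.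
Qed.

(** * Masses on a chain recovered from its two projections *)

Section Masses.
Variables (q : 'I_m.+2 -> 'rV[int]_m.+1) (u : 'I_m.+2 -> R).
Hypotheses (Sq : prism_simplices q) (wu : weights u).

Let above (v : 'rV[int]_m) : pred 'rV[int]_m := fun w => (w == v) || `[< P (w - v) >].
Let strictly_above (v : 'rV[int]_m) : pred 'rV[int]_m := fun w => `[< P (w - v) >].

(** The clamp treats c <= k, c = k + 1 and c >= k + 2 at once, so the formula is free of the slab
    index and agrees for simplices of adjacent slabs at a common point. *)
Lemma prism_head_sum (c : int) : \sum_(j | c <= q j 0 0) u j =
  Num.max 0 (Num.min 1 (barycenter u q 0 0 - c%:~R + 1)).
Proof.
have [_ [p [k [_ qk]]]] := Sq.
have -> : barycenter u q 0 0 = k%:~R + \sum_(j | q j 0 0 == k + 1) u j.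
  have -> : k%:~R = \sum_j u j * k%:~R by rewrite -mulr_suml wu.2 mul1r.
  rewrite head_barycenter [X in _ + X]big_mkcond -big_split/=; apply: eq_bigr => j _.
  have [_ [->|->]] := qk j; last by rewrite eqxx intrD mulrDr mulr1.
  by rewrite (_ : (k == k + 1) = false) ?addr0//; lia.
set s := \sum_(j | q j 0 0 == k + 1) u j.
have s0 : 0 <= s by apply: sumr_ge0 => j _; exact: wu.1.
have s1 : s <= 1.
  rewrite -wu.2 /s [leLHS]big_mkcond; apply: ler_sum => j _.
  by case: ifP => // _; exact: wu.1.
have [ck|kc] := leP c k.
  have ckR : c%:~R <= k%:~R :> R by rewrite ler_int.
  rewrite min_l ?max_r//; last by lra.
  rewrite -[RHS]wu.2; apply: eq_bigl => j.
  by have [_ [->|->]] := qk j => //; lia.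
have [kc1|kc1] := eqVneq c (k + 1).
  rewrite (_ : _ - _ + 1 = s); last by rewrite kc1 intrD; ring.
  rewrite min_r// max_r//; apply: eq_bigl => j.
  by rewrite kc1; have [_ [->|->]] := qk j; lia.
have ckR : (k + 2)%:~R <= c%:~R :> R by rewrite ler_int; lia.
rewrite intrD in ckR.
rewrite min_r; last by lra.
rewrite max_l; last by lra.
by rewrite big_pred0// => j; have [_ [->|->]] := qk j; lia.
Qed.

Let P0 : ~ P 0.
Proof. by move=> P0; have := ot_asym otP P0; rewrite oppr0; apply. Qed.

Let tail_le (i j : 'I_m.+2) : (i < j)%N ->
  row_tail (q i) = row_tail (q j) \/ P (row_tail (q j) - row_tail (q i)).
Proof.
move=> ij; have [_ + _] := Sq.1 _ _ ij; rewrite row_tailD row_tailN.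
by case=> [/subr0_eq ->|]; [left|right].
Qed.

Let head_lt i j : q i 0 0 < q j 0 0 -> (i < j)%N.
Proof.
case: (ltngtP i j) => // [ji|/val_inj ->]; last by rewrite ltxx.
by have [_ _] := Sq.1 _ _ ji; rewrite !mxE subr_ge0 leNgt => /negP.
Qed.

Let asymm v w : P (v - w) -> ~ P (w - v).
Proof. by move=> /(ot_asym otP); rewrite opprB. Qed.

(* [q] is a chain, so its members with tail above a given one of its tails and
   its members with head at least [c] are nested. *)
Lemma prism_corner j0 (c : int) :
  \sum_(j | above (row_tail (q j0)) (row_tail (q j)) && (c <= q j 0 0)) u j =
  Num.min (\sum_(j | above (row_tail (q j0)) (row_tail (q j))) u j)
          (\sum_(j | c <= q j 0 0) u j).
Proof.
apply: (sum_nested (E := fun j => above (row_tail (q j0)) (row_tail (q j)))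
  (C := fun j => c <= q j 0 0)) => [|i j Ei]; first exact: wu.1.
rewrite -ltNge => ic cj; have /head_lt ij := lt_le_trans ic cj.
have [ij0|ij0] := eqVneq (row_tail (q i)) (row_tail (q j0)).
  have := tail_le ij; rewrite ij0 /above => -[<-|Pj]; first by rewrite eqxx.
  by apply/orP; right; apply/asboolP.
move: Ei; rewrite /above (negPf ij0) /= => /asboolP Pi.
have j0i : (j0 <= i)%N.
  rewrite leqNgt; apply/negP => /tail_le Hi; case: Hi => [ji|/asymm]; last by apply.
  by rewrite ji eqxx in ij0.
rewrite /above; case: (tail_le (leq_ltn_trans j0i ij)) => [<-|Pj].
  by rewrite eqxx.
by apply/orP; right; apply/asboolP.
Qed.

Lemma prism_strict_corner j0 (c : int) :
  \sum_(j | strictly_above (row_tail (q j0)) (row_tail (q j)) && (c <= q j 0 0)) u j =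
  Num.min (\sum_(j | strictly_above (row_tail (q j0)) (row_tail (q j))) u j)
          (\sum_(j | c <= q j 0 0) u j).
Proof.
apply: (sum_nested (E := fun j => strictly_above (row_tail (q j0)) (row_tail (q j)))
  (C := fun j => c <= q j 0 0)) => [|i j /asboolP Pi]; first exact: wu.1.
rewrite -ltNge => ic cj; have /head_lt ij := lt_le_trans ic cj.
have j0i : (j0 <= i)%N.
  rewrite leqNgt; apply/negP => /tail_le Hi; case: Hi => [ij0|/asymm]; last by apply.
  by apply: P0; rewrite -[X in P X](subrr (row_tail (q j0))) -{1}ij0.
apply/asboolP; case: (tail_le (leq_ltn_trans j0i ij)) => // jj0.
exfalso; case: (tail_le ij) => [ij0|]; last by rewrite -jj0 => /asymm; apply.
by apply: P0; rewrite -[X in P X](subrr (row_tail (q j0))) {1}jj0 -ij0.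
Qed.

(** Inclusion-exclusion isolates [w] by four corners, each an intersection of nested sets. The mass
    thus depends only on the tail masses and on the height of the barycenter. *)
Lemma prism_mass j0 w (t := barycenter u q 0 0)
    (f := fun c : int => Num.max 0 (Num.min 1 (t - c%:~R + 1))) :
  row_tail (q j0) = row_tail w -> mass u q w =
    let A := \sum_(j | above (row_tail w) (row_tail (q j))) u j in
    let B := \sum_(j | strictly_above (row_tail w) (row_tail (q j))) u j in
    Num.min A (f (w 0 0)) - Num.min B (f (w 0 0))
    - Num.min A (f (w 0 0 + 1)) + Num.min B (f (w 0 0 + 1)).
Proof.
move=> j0w /=; rewrite /f /t -!prism_head_sum -j0w.
rewrite -!prism_corner -!prism_strict_corner j0w.
rewrite /mass big_mkcond [X in _ = X - _ - _ + _]big_mkcond.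
rewrite [X in _ = _ - X - _ + _]big_mkcond [X in _ = _ - X + _]big_mkcond.
rewrite [X in _ = _ + X]big_mkcond/= -!sumrN -!big_split/=; apply: eq_bigr => j _.
rewrite /above /strictly_above lezD1.
have -> : (q j == w) = (row_tail (q j) == row_tail w) && (q j 0 0 == w 0 0).
  by apply/eqP/andP => [->//|[/eqP qt /eqP q0]]; exact: row_consP.
have [->|] := eqVneq (row_tail (q j)) (row_tail w).
  rewrite subrr (_ : `[< P 0 >] = false); last exact/asboolP.
  case: (ltgtP (q j 0 0) (w 0 0)) => /= _; ring.
by move=> _ /=; ring.
Qed.
End Masses.

(** Uniqueness in the base equates the tail masses, and [prism_mass] recovers the masses from these
    and the height. *)
Lemma prism_uniq q q' (u u' : 'I_m.+2 -> R) :
  prism_simplices q -> prism_simplices q' -> weights u -> weights u' ->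
  barycenter u q = barycenter u' q' -> mass u q =1 mass u' q'.
Proof.
(* Several members of a chain may share a tail; adding their weights gives weights on a simplex of
   the base. *)
have tails r (w : 'I_m.+2 -> R) : prism_simplices r -> weights w ->
    exists p w', [/\ Sg p, weights w',
      barycenter w' p = row_tail (barycenter w r)
    & mass w' p =1 mass w (row_tail \o r)].
  move=> [_ [p [k [Sp rk]]]] [w0 w1].
  have /choice[f fr] j : exists i, p i = row_tail (r j).
    by have [[i _ <-] _] := rk j; exists i.
  exists p, (fun i => \sum_(j | f j == i) w j).
  have sumf (V : nmodType) (F : 'I_m.+1 -> 'I_m.+2 -> V) :
      \sum_i \sum_(j | f j == i) F i j = \sum_j F (f j) j.
    rewrite (exchange_big_dep xpredT)//=; apply: eq_bigr => j _.
    by rewrite (big_pred1 (f j))// => i; rewrite /= eq_sym.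
  split=> //.
  - by split=> [i|]; [exact: sumr_ge0|rewrite sumf].
  - rewrite tail_barycenter /barycenter.
    under eq_bigr do rewrite scaler_suml.
    by rewrite sumf; apply: eq_bigr => j _; rewrite fr.
  - move=> v; rewrite /mass big_mkcond/=.
    have E i : (if p i == v then \sum_(j | f j == i) w j else 0) =
        \sum_(j | f j == i) (if p i == v then w j else 0).
      by case: ifP => // _; rewrite big1.
    rewrite (eq_bigr _ (fun i _ => E i)) sumf [RHS]big_mkcond/=.
    by apply: eq_bigr => j _; rewrite fr.
move=> Sq Sq' wu wu' bq.
have [p [w [Sp ww bp mp]]] := tails _ _ Sq wu.
have [p' [w' [Sp' ww' bp' mp']]] := tails _ _ Sq' wu'.
have mt : mass u (row_tail \o q) =1 mass u' (row_tail \o q').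
  move=> v; rewrite -mp -mp'; apply: (ot_uniq otP) => //.
  by rewrite bp bp' bq.
have eqE (E : pred 'rV[int]_m) :
    \sum_(j | E (row_tail (q j))) u j = \sum_(j | E (row_tail (q' j))) u' j.
  exact: (mass_eq_sum (p := row_tail \o q) (p' := row_tail \o q')).
have massE z j j' : row_tail (q j) = row_tail z -> row_tail (q' j') = row_tail z ->
    mass u q z = mass u' q' z.
  move=> qj qj'; rewrite (prism_mass Sq wu qj) (prism_mass Sq' wu' qj') bq /=.
  by rewrite !(eqE (fun v => (v == row_tail z) || `[< P (v - row_tail z) >]))
    !(eqE (fun v => `[< P (v - row_tail z) >])).
(* [prism_mass] requires a member over the tail of [z] in both chains; a nonzero mass on one side
   provides it, because the tail masses agree. *)
move=> z; have [/eqP u0|/mass_neq0[j qj uj]] := boolP (mass u q z == 0); last first.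
  have : mass u (row_tail \o q) (row_tail z) != 0.
    rewrite -qj gt_eqF// (mass_gt0 (row_tail \o q) (i := j))//.
    by rewrite lt_neqAle eq_sym uj wu.1.
  rewrite mt => /mass_neq0[j' qj' _].
  exact: massE (congr1 _ qj) qj'.
have [/eqP u'0|/mass_neq0[j qj uj]] := boolP (mass u' q' z == 0).
  by rewrite u0 u'0.
have : mass u' (row_tail \o q') (row_tail z) != 0.
  rewrite -qj gt_eqF// (mass_gt0 (row_tail \o q') (i := j))//.
  by rewrite lt_neqAle eq_sym uj wu'.1.
rewrite -mt => /mass_neq0[j' qj' _].
exact: massE qj' (congr1 _ qj).
Qed.

Theorem prism_triangulation : ordered_triangulation R prism_simplices prism_order.
Proof.
split.
- by move=> q [+ _].
- move=> w [w0 tw hw] [_ tw' hw']; apply: w0; apply: row_consP.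
    by move: hw'; rewrite !mxE oppr_ge0 => hw'; apply/eqP; rewrite eq_le hw' hw.
  rewrite (_ : row_tail 0 = 0); last by apply/rowP => j; rewrite !mxE.
  case: tw => // Pw; move: tw'; rewrite row_tailN.
  case=> [/eqP|/(ot_asym otP)]; last by rewrite opprK.
  by rewrite oppr_eq0 => /eqP.
- move=> q v [cq [p [k [Sp qk]]]]; split.
    by move=> i j ij; rewrite opprD addrACA subrr addr0; exact: cq.
  exists (fun i => p i + row_tail v), (k + v 0 0); split.
    exact: (ot_shift otP).
  move=> j; have [[i _ pi] kj] := qk j; split.
    by exists i => //; rewrite row_tailD pi.
  by rewrite !mxE; case: kj => ->; [left|right]; rewrite // addrAC.
- move=> q [cq [p [k [Sp qk]]]]; split.
    move=> i j ij; rewrite opprK addrC; apply: cq => /=.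
    by have := ltn_ord j; lia.
  (* Reflection sends the slab [k, k + 1] to [- k - 1, - k]. *)
  exists (fun i => - p (rev_ord i)), (- k - 1); split; first exact: (ot_opp otP).
  move=> j; have [[i _ pi] kj] := qk (rev_ord j); split.
    by exists (rev_ord i) => //; rewrite row_tailN rev_ordK pi.
  by rewrite !mxE; case: kj => ->; [right|left]; lia.
- exact: prism_cover.
- exact: prism_uniq.
Qed.

End Prism.

(** * The D4 cells *)

Lemma increasing_perm n (k : 'I_n -> int) : injective k ->
  exists2 s : 'I_n -> 'I_n, injective s & forall i j : 'I_n, (i < j)%N -> k (s i) < k (s j).
Proof.
case: n k => [|n] k kI; first by exists id => // -[].
pose e : rel 'I_n.+1 := fun i j => k i <= k j.
pose l := sort e (enum 'I_n.+1).
have sl : size l = n.+1 by rewrite size_sort size_enum_ord.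
have ul : uniq l by rewrite sort_uniq enum_uniq.
have fI : injective (fun i : 'I_n.+1 => nth ord0 l i).
  move=> i j /eqP; rewrite nth_uniq ?sl ?ltn_ord// => /eqP.
  exact: val_inj.
exists (fun i : 'I_n.+1 => nth ord0 l i) => // i j ij; rewrite lt_neqAle.
have etr : transitive e by move=> a b c; exact: le_trans.
have el : sorted e l by apply: sort_sorted => a b; exact: le_total.
have -> : k (nth ord0 l i) <= k (nth ord0 l j).
  have := sorted_ltn_nth etr ord0 el; move=> /(_ i j).
  by rewrite !inE sl !ltn_ord; apply.
by rewrite andbT; apply/eqP => /kI/fI ij'; move: ij; rewrite ij' ltnn.
Qed.


Definition vec4 (V : zmodType) (a b c d : V) : 'rV[V]_4 :=
  \row_i nth 0 [:: a; b; c; d] i.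

Local Notation c0 v := (v ord0 (@Ordinal 4 0 isT)).
Local Notation c1 v := (v ord0 (@Ordinal 4 1 isT)).
Local Notation c2 v := (v ord0 (@Ordinal 4 2 isT)).
Local Notation c3 v := (v ord0 (@Ordinal 4 3 isT)).

Lemma vec4P (V : zmodType) (v w : 'rV[V]_4) :
  c0 v = c0 w -> c1 v = c1 w -> c2 v = c2 w -> c3 v = c3 w -> v = w.
Proof.
move=> e0 e1 e2 e3; apply/rowP => -[[|[|[|[|//]]]] i4].
- by rewrite (_ : Ordinal i4 = @Ordinal 4 0 isT)//; exact: val_inj.
- by rewrite (_ : Ordinal i4 = @Ordinal 4 1 isT)//; exact: val_inj.
- by rewrite (_ : Ordinal i4 = @Ordinal 4 2 isT)//; exact: val_inj.
- by rewrite (_ : Ordinal i4 = @Ordinal 4 3 isT)//; exact: val_inj.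
Qed.

(* Triality of the D4 lattice, which is Z^4 with the form [norm_form] below. *)
Definition tau (y : 'rV[int]_4) : 'rV[int]_4 :=
  vec4 (- c0 y - c0 y - c1 y - c2 y - c3 y)
    (c0 y + c1 y) (c0 y + c2 y) (c0 y + c3 y).

(** Every exponent above 1 stands for 2, so that any natural number names one of the three
    classes. *)
Definition tau_pow (t : nat) (y : 'rV[int]_4) :=
  match t with 0 => y | 1 => tau y | _ => tau (tau y) end.

Definition tau_inv (t : nat) (y : 'rV[int]_4) :=
  match t with 0 => y | 1 => tau (tau y) | _ => tau y end.

Lemma tauE y : [/\ c0 (tau y) = - c0 y - c0 y - c1 y - c2 y - c3 y,
  c1 (tau y) = c0 y + c1 y, c2 (tau y) = c0 y + c2 y & c3 (tau y) = c0 y + c3 y].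
Proof. by split; rewrite mxE. Qed.

Lemma tau3 y : tau (tau (tau y)) = y.
Proof.
have [a0 a1 a2 a3] := tauE y; have [b0 b1 b2 b3] := tauE (tau y).
have [d0 d1 d2 d3] := tauE (tau (tau y)).
by apply: vec4P; rewrite ?d0 ?d1 ?d2 ?d3 ?b0 ?b1 ?b2 ?b3 ?a0 ?a1 ?a2 ?a3;
  move: (c0 y) (c1 y) (c2 y) (c3 y) => *; lia.
Qed.

Lemma tauB v w : tau (v - w) = tau v - tau w.
Proof.
by apply: vec4P; rewrite !mxE /=;
  move: (c0 v) (c1 v) (c2 v) (c3 v) (c0 w) (c1 w) (c2 w) (c3 w) => *; lia.
Qed.

Lemma tau_powK t : cancel (tau_pow t) (tau_inv t).
Proof. by case: t => [|[|t]] y //=; rewrite tau3. Qed.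

Lemma tau_invK t : cancel (tau_inv t) (tau_pow t).
Proof. by case: t => [|[|t]] y //=; rewrite tau3. Qed.

Lemma tau_powB t v w : tau_pow t (v - w) = tau_pow t v - tau_pow t w.
Proof. by case: t => [|[|t]] //=; rewrite !tauB. Qed.

(** * Covering space by the cells *)

Section CellCover.
Variable R : realFieldType.

Definition pos_part (s : bool) (b : R) := if s then b else 0.
Definition neg_part (s : bool) (b : R) := if s then 0 else - b.

(* The simplex with vertices 0, (1; 0, 0, 0) and, for each j, either (0; e_j) or
   (1; - e_j) according to [sj]. *)
Definition in_cell (s1 s2 s3 : bool) (a b1 b2 b3 : R) : Prop :=
  [/\ 0 <= pos_part s1 b1 + neg_part s1 b1,
      0 <= pos_part s2 b2 + neg_part s2 b2,
      0 <= pos_part s3 b3 + neg_part s3 b3,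
      neg_part s1 b1 + neg_part s2 b2 + neg_part s3 b3 <= a
    & a + pos_part s1 b1 + pos_part s2 b2 + pos_part s3 b3 <= 1].

(** With the signs of the coordinates as [s1], [s2], [s3], only the last two conditions remain. Over
    all sign patterns these are the 16 facet inequalities of the cross-polytope. *)
Lemma in_cell_intro (a b1 b2 b3 : R) :
  (forall s1 s2 s3, neg_part s1 b1 + neg_part s2 b2 + neg_part s3 b3 <= a /\
     a + pos_part s1 b1 + pos_part s2 b2 + pos_part s3 b3 <= 1) ->
  exists s1 s2 s3, in_cell s1 s2 s3 a b1 b2 b3.
Proof.
move=> H; exists (0 <= b1), (0 <= b2), (0 <= b3).
have [H1 H2] := H (0 <= b1) (0 <= b2) (0 <= b3).
by split=> //; rewrite /pos_part /neg_part;
  [case: (leP 0 b1)|case: (leP 0 b2)|case: (leP 0 b3)] => ?; lra.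
Qed.

(* [y0, ..., y3] are the coordinates of a point relative to the origin of a cell
   of class [t]; the arguments of [in_cell] are the coordinates of its image
   under the inverse of tau^t. *)
Definition in_class_cell (t : nat) s1 s2 s3 (y0 y1 y2 y3 : R) : Prop :=
  match t with
  | 0 => in_cell s1 s2 s3 y0 y1 y2 y3
  | 1 => in_cell s1 s2 s3 (y0 + y1 + y2 + y3)
           (- y0 - y2 - y3) (- y0 - y1 - y3) (- y0 - y1 - y2)
  | _ => in_cell s1 s2 s3 (- y0 - y0 - y1 - y2 - y3) (y0 + y1) (y0 + y2) (y0 + y3)
  end.

End CellCover.

Lemma odd_center_cell (R : realType) (x0 x1 x2 x3 : R) (o1 o2 o3 o4 z : int)
  (g1 := x0 + x1 - o1%:~R) (g2 := x0 + x2 - o2%:~R)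
  (g3 := x0 + x3 - o3%:~R) (g4 := x0 + x1 + x2 + x3 - o4%:~R) :
  o1 + o2 + o3 - o4 = z + z + 1 -> `|g1| + `|g2| + `|g3| + `|g4| <= 1 ->
  exists t (z0 z1 z2 z3 : int) s1 s2 s3, in_class_cell t s1 s2 s3
    (x0 - z0%:~R) (x1 - z1%:~R) (x2 - z2%:~R) (x3 - z3%:~R).
Proof.
(* In the coordinates of [o1], ..., [o4] this origin is the odd center plus the last unit vector,
   one end of the diagonal of the class 2 cell. *)
move=> oz g; exists 2%N, z, (o1 - z), (o2 - z), (o3 - z).
have E : o1%:~R + o2%:~R + o3%:~R - o4%:~R = z%:~R + z%:~R + 1 :> R.
  by have := congr1 (intmul (1 : R)) oz; rewrite !intrD mulrNz.
rewrite /in_class_cell; apply: in_cell_intro => s1 s2 s3.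
rewrite !intrD !mulrNz.
have := ler_norm g1; have := ler_norm (- g1); have := ler_norm g2.
have := ler_norm (- g2); have := ler_norm g3; have := ler_norm (- g3).
have := ler_norm g4; have := ler_norm (- g4); rewrite !normrN.
have := normr_ge0 g1; have := normr_ge0 g2; have := normr_ge0 g3.
move: g; rewrite /g1 /g2 /g3 /g4 /pos_part /neg_part.
move: `|_| `|_| `|_| `|_| => n1 n2 n3 n4.
by case: s1; case: s2; case: s3; split; lra.
Qed.

(** The 16 facets of the cross-polytope come from the 8 facets of the cube and the 8 cuts at its odd
    vertices. The value [a] is [y0]: the first three functions minus the fourth give twice that
    coordinate. *)
Lemma even_cube_cell (R : realFieldType) (f1 f2 f3 f4 : R) :
  0 <= f1 -> f1 <= 1 -> 0 <= f2 -> f2 <= 1 ->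
  0 <= f3 -> f3 <= 1 -> 0 <= f4 -> f4 <= 1 ->
  1 < (1 - f1) + f2 + f3 + f4 -> 1 < f1 + (1 - f2) + f3 + f4 ->
  1 < f1 + f2 + (1 - f3) + f4 -> 1 < f1 + f2 + f3 + (1 - f4) ->
  1 < (1 - f1) + (1 - f2) + (1 - f3) + f4 -> 1 < (1 - f1) + (1 - f2) + f3 + (1 - f4) ->
  1 < (1 - f1) + f2 + (1 - f3) + (1 - f4) -> 1 < f1 + (1 - f2) + (1 - f3) + (1 - f4) ->
  let a := (f1 + f2 + f3 - f4) / 2 in
  exists s1 s2 s3, in_cell s1 s2 s3 a (f1 - a) (f2 - a) (f3 - a).
Proof.
move=> f10 f11 f20 f21 f30 f31 f40 f41 h1 h2 h3 h4 h5 h6 h7 h8 a; apply: in_cell_intro => s1 s2 s3.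
rewrite /a /pos_part /neg_part.
by case: s1; case: s2; case: s3; split; lra.
Qed.

(** The same count of facets for an odd origin. The arguments of [in_cell] are coordinates relative
    to the vertex (1, 1, 1, 0) of the cube, after the inverse of [tau]. *)
Lemma odd_cube_cell (R : realFieldType) (f1 f2 f3 f4 : R) :
  0 <= f1 -> f1 <= 1 -> 0 <= f2 -> f2 <= 1 ->
  0 <= f3 -> f3 <= 1 -> 0 <= f4 -> f4 <= 1 ->
  1 < f1 + f2 + f3 + f4 -> 1 < (1 - f1) + (1 - f2) + (1 - f3) + (1 - f4) ->
  1 < (1 - f1) + (1 - f2) + f3 + f4 -> 1 < (1 - f1) + f2 + (1 - f3) + f4 ->
  1 < f1 + (1 - f2) + (1 - f3) + f4 -> 1 < (1 - f1) + f2 + f3 + (1 - f4) ->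
  1 < f1 + (1 - f2) + f3 + (1 - f4) -> 1 < f1 + f2 + (1 - f3) + (1 - f4) ->
  let a := (f1 + f2 + f3 + f4 - 3) / 2 in
  exists s1 s2 s3, in_cell s1 s2 s3 f4 (f1 - 1 - a) (f2 - 1 - a) (f3 - 1 - a).
Proof.
move=> f10 f11 f20 f21 f30 f31 f40 f41 h1 h2 h3 h4 h5 h6 h7 h8 a; apply: in_cell_intro => s1 s2 s3.
rewrite /a /pos_part /neg_part.
by case: s1; case: s2; case: s3; split; lra.
Qed.

(* The functions x0 + x1, x0 + x2, x0 + x3 and x0 + x1 + x2 + x3 identify Z^4 with
   the vectors of even coordinate sum.  The even vertices of a unit cube span a
   cell of class 0 or 1, according to the parity of its origin, and the rest of
   the cube is covered by cells of class 2, centered at its odd vertices. *)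
Lemma cell_cover (R : realType) (x0 x1 x2 x3 : R) :
  exists t (z0 z1 z2 z3 : int) s1 s2 s3, in_class_cell t s1 s2 s3
    (x0 - z0%:~R) (x1 - z1%:~R) (x2 - z2%:~R) (x3 - z3%:~R).
Proof.
have frac (y : R) : exists (n : int) (f : R), [/\ y = n%:~R + f, 0 <= f & f <= 1].
  exists (Num.floor y), (y - (Num.floor y)%:~R); split.
  - by rewrite addrC subrK.
  - by rewrite subr_ge0 ge_floor.
  - by rewrite lerBlDl -[1]/(1%:~R) -intrD ltW// lt_succ_floor.
have [n1 [f1 [W1 f10 f11]]] := frac (x0 + x1).
have [n2 [f2 [W2 f20 f21]]] := frac (x0 + x2).
have [n3 [f3 [W3 f30 f31]]] := frac (x0 + x3).
have [n4 [f4 [W4 f40 f41]]] := frac (x0 + x1 + x2 + x3).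
(* A point at l1-distance at most 1 from an odd vertex lies in a cell of class 2. In each parity
   case the eight instances exhaust the odd vertices of the cube. *)
have corner (e1 e2 e3 e4 z : int) :
    (n1 + e1) + (n2 + e2) + (n3 + e3) - (n4 + e4) = z + z + 1 ->
    `|f1 - e1%:~R| + `|f2 - e2%:~R| + `|f3 - e3%:~R| + `|f4 - e4%:~R| <= 1 ->
    exists t (z0 z1 z2 z3 : int) s1 s2 s3, in_class_cell t s1 s2 s3
      (x0 - z0%:~R) (x1 - z1%:~R) (x2 - z2%:~R) (x3 - z3%:~R).
  move=> oz H; apply: odd_center_cell oz _; rewrite W4 W1 W2 W3 !intrD.
  have A (n f e : R) : n + f - (n + e) = f - e by ring.
  by rewrite !A.
have n0 (f : R) : 0 <= f -> `|f - 0%:~R| = f by move=> ?; rewrite subr0 ger0_norm.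
have n1' (f : R) : f <= 1 -> `|f - 1%:~R| = 1 - f.
  by move=> ?; rewrite ler0_norm ?opprB// subr_le0.
have [z [ez|ez]] : exists z : int, n1 + n2 + n3 - n4 = z + z \/
    n1 + n2 + n3 - n4 = z + z + 1.
  by exists ((n1 + n2 + n3 - n4) %/ 2)%Z; clear; lia.
- have E : n1%:~R + n2%:~R + n3%:~R - n4%:~R = z%:~R + z%:~R :> R.
    by have := congr1 (intmul (1 : R)) ez; rewrite !intrD mulrNz.
  have c1 := corner 1 0 0 0 z ltac:(clear -ez; lia).
  have c2 := corner 0 1 0 0 z ltac:(clear -ez; lia).
  have c3 := corner 0 0 1 0 z ltac:(clear -ez; lia).
  have c4 := corner 0 0 0 1 (z - 1) ltac:(clear -ez; lia).
  have c5 := corner 1 1 1 0 (z + 1) ltac:(clear -ez; lia).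
  have c6 := corner 1 1 0 1 z ltac:(clear -ez; lia).
  have c7 := corner 1 0 1 1 z ltac:(clear -ez; lia).
  have c8 := corner 0 1 1 1 z ltac:(clear -ez; lia).
  rewrite !n0// !n1'// in c1 c2 c3 c4 c5 c6 c7 c8.
  have [/c1//|h1] := leP ((1 - f1) + f2 + f3 + f4) 1.
  have [/c2//|h2] := leP (f1 + (1 - f2) + f3 + f4) 1.
  have [/c3//|h3] := leP (f1 + f2 + (1 - f3) + f4) 1.
  have [/c4//|h4] := leP (f1 + f2 + f3 + (1 - f4)) 1.
  have [/c5//|h5] := leP ((1 - f1) + (1 - f2) + (1 - f3) + f4) 1.
  have [/c6//|h6] := leP ((1 - f1) + (1 - f2) + f3 + (1 - f4)) 1.
  have [/c7//|h7] := leP ((1 - f1) + f2 + (1 - f3) + (1 - f4)) 1.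
  have [/c8//|h8] := leP (f1 + (1 - f2) + (1 - f3) + (1 - f4)) 1.
  exists 0%N, z, (n1 - z), (n2 - z), (n3 - z).
  have [s1 [s2 [s3]]] := even_cube_cell f10 f11 f20 f21 f30 f31 f40 f41
    h1 h2 h3 h4 h5 h6 h7 h8.
  clear -E W1 W2 W3 W4 => H; exists s1, s2, s3; move: H.
  rewrite /in_class_cell !(intrD, mulrNz).
  by congr in_cell; lra.
- have E : n1%:~R + n2%:~R + n3%:~R - n4%:~R = z%:~R + z%:~R + 1 :> R.
    by have := congr1 (intmul (1 : R)) ez; rewrite !intrD mulrNz.
  have c1 := corner 0 0 0 0 z ltac:(clear -ez; lia).
  have c2 := corner 1 1 1 1 (z + 1) ltac:(clear -ez; lia).
  have c3 := corner 1 1 0 0 (z + 1) ltac:(clear -ez; lia).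
  have c4 := corner 1 0 1 0 (z + 1) ltac:(clear -ez; lia).
  have c5 := corner 0 1 1 0 (z + 1) ltac:(clear -ez; lia).
  have c6 := corner 1 0 0 1 z ltac:(clear -ez; lia).
  have c7 := corner 0 1 0 1 z ltac:(clear -ez; lia).
  have c8 := corner 0 0 1 1 z ltac:(clear -ez; lia).
  rewrite !n0// ?n1'// in c1 c2 c3 c4 c5 c6 c7 c8.
  have [/c1//|h1] := leP (f1 + f2 + f3 + f4) 1.
  have [/c2//|h2] := leP ((1 - f1) + (1 - f2) + (1 - f3) + (1 - f4)) 1.
  have [/c3//|h3] := leP ((1 - f1) + (1 - f2) + f3 + f4) 1.
  have [/c4//|h4] := leP ((1 - f1) + f2 + (1 - f3) + f4) 1.
  have [/c5//|h5] := leP (f1 + (1 - f2) + (1 - f3) + f4) 1.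
  have [/c6//|h6] := leP ((1 - f1) + f2 + f3 + (1 - f4)) 1.
  have [/c7//|h7] := leP (f1 + (1 - f2) + f3 + (1 - f4)) 1.
  have [/c8//|h8] := leP (f1 + f2 + (1 - f3) + (1 - f4)) 1.
  (* In these coordinates the origin of the cell is [n + (1, 1, 1, 0)]. *)
  exists 1%N, (z + 2), (n1 - z - 1), (n2 - z - 1), (n3 - z - 1).
  have [s1 [s2 [s3]]] := odd_cube_cell f10 f11 f20 f21 f30 f31 f40 f41
    h1 h2 h3 h4 h5 h6 h7 h8.
  clear -E W1 W2 W3 W4 => H; exists s1, s2, s3; move: H.
  rewrite /in_class_cell !(intrD, mulrNz).
  by congr in_cell; lra.
Qed.

(** * Vertices of the cells and their order *)

Definition axis : 'rV[int]_4 := vec4 1 0 0 0.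

Definition cell_vertex (s1 s2 s3 : bool) (i : 'I_5) : 'rV[int]_4 :=
  nth 0 [:: 0; axis; if s1 then vec4 0 1 0 0 else vec4 1 (-1) 0 0;
    if s2 then vec4 0 0 1 0 else vec4 1 0 (-1) 0;
    if s3 then vec4 0 0 0 1 else vec4 1 0 0 (-1)] i.

(** The coefficients 1, 2, -3 sum to 0, whence invariance under [tau]; without a [c0] term it
    vanishes on the cut diagonals. At the other vertices of a cell the values are nonzero and
    distinct. *)
Definition height (y : 'rV[int]_4) : int :=
  c1 y + c2 y + c2 y - c3 y - c3 y - c3 y.

Definition base_order : set 'rV[int]_4 :=
  [set v | 0 < height v \/ exists t, v = tau_pow t axis].

(** The chain condition makes [p] injective, so it lists all five vertices of a simplex. *)
Definition base_simplices : set ('I_5 -> 'rV[int]_4) :=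
  [set p | (forall i j : 'I_5, (i < j)%N -> base_order (p j - p i)) /\
    exists t z s1 s2 s3, forall i, exists k,
      p i = z + tau_pow t (cell_vertex s1 s2 s3 k)].

Lemma heightN y : height (- y) = - height y.
Proof.
by rewrite /height !mxE; move: (c1 y) (c2 y) (c3 y) => *; lia.
Qed.

Lemma height_tau y : height (tau y) = height y.
Proof.
rewrite /height; have [_ -> -> ->] := tauE y.
by move: (c0 y) (c1 y) (c2 y) (c3 y) => *; lia.
Qed.

Lemma height_tau_pow t y : height (tau_pow t y) = height y.
Proof. by case: t => [|[|t]] //=; rewrite !height_tau. Qed.

Lemma tau_axis : tau axis = vec4 (-2) 1 1 1.
Proof. by apply: vec4P; rewrite !mxE. Qed.

Lemma tau2_axis : tau (tau axis) = vec4 1 (-1) (-1) (-1).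
Proof. by rewrite tau_axis; apply: vec4P; rewrite !mxE. Qed.

Lemma heightB y z : height (y - z) = height y - height z.
Proof.
rewrite /height !mxE; move: (c1 y) (c2 y) (c3 y) (c1 z) (c2 z) (c3 z) => *.
by lia.
Qed.

Lemma base_order_asym v : base_order v -> ~ base_order (- v).
Proof.
have h0 : height axis = 0 by rewrite /height !mxE.
case=> [hv|[t ->]]; case; rewrite ?heightN ?height_tau_pow ?h0//.
- lia.
- by move=> [t vt]; move: hv; rewrite -[v]opprK vt heightN height_tau_pow h0.
(* The first coordinates 1 and -2 show that no diagonal is the opposite of another. *)
have E i : c0 (tau_pow i axis) = 1 \/ c0 (tau_pow i axis) = -2.
  by case: i => [|[|i]] /=; rewrite ?tau2_axis ?tau_axis mxE; [left|right|left].
move=> [t' /rowP/(_ (@Ordinal 4 0 isT))]; rewrite mxE.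
by case: (E t) => ->; case: (E t') => ->.
Qed.

(** The doubled height dominates [c0], which is 0 or 1 on a cell and breaks the tie between 0 and
    [axis]. *)
Definition sort_key (y : 'rV[int]_4) : int := c0 y + height y + height y.

Lemma cell_vertexE s1 s2 s3 i (v := cell_vertex s1 s2 s3 i) :
  [/\ c0 v = nth 0 [:: 0; 1; (~~ s1)%:R; (~~ s2)%:R; (~~ s3)%:R] i,
      c1 v = nth 0 [:: 0; 0; (-1) ^+ ~~ s1; 0; 0] i,
      c2 v = nth 0 [:: 0; 0; 0; (-1) ^+ ~~ s2; 0] i
    & c3 v = nth 0 [:: 0; 0; 0; 0; (-1) ^+ ~~ s3] i].
Proof.
rewrite {}/v /cell_vertex; case: i => [[|[|[|[|[|//]]]]] i5] /=.
- by split; rewrite mxE.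
- by split; rewrite mxE.
- by case: s1; split; rewrite mxE.
- by case: s2; split; rewrite mxE.
- by case: s3; split; rewrite mxE.
Qed.

Lemma height_cell_vertex s1 s2 s3 i : height (cell_vertex s1 s2 s3 i) =
  nth 0 [:: 0; 0; (-1) ^+ ~~ s1; 2 * (-1) ^+ ~~ s2; -3 * (-1) ^+ ~~ s3] i.
Proof.
rewrite /height; have [_ -> -> ->] := cell_vertexE s1 s2 s3 i.
case: i => [[|[|[|[|[|//]]]]] i5] //=; [case: s1|case: s2|case: s3]; reflexivity.
Qed.

Lemma sort_key_cell_vertex s1 s2 s3 i : sort_key (cell_vertex s1 s2 s3 i) =
  nth 0 [:: 0; 1; if s1 then 2 else -1; if s2 then 4 else -3; if s3 then -6 else 7] i.
Proof.
rewrite /sort_key height_cell_vertex; have [-> _ _ _] := cell_vertexE s1 s2 s3 i.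
case: i => [[|[|[|[|[|//]]]]] i5] //=; [case: s1|case: s2|case: s3]; reflexivity.
Qed.

Lemma sort_key_inj s1 s2 s3 : injective (fun i => sort_key (cell_vertex s1 s2 s3 i)).
Proof.
move=> i j; rewrite !sort_key_cell_vertex => /eqP E; apply: val_inj; move: E.
case: i j => [[|[|[|[|[|//]]]]] i5] [[|[|[|[|[|//]]]]] j5] //=;
  by case: s1; case: s2; case: s3.
Qed.

Lemma sort_key_lt s1 s2 s3 i j (y := cell_vertex s1 s2 s3 j - cell_vertex s1 s2 s3 i) :
  sort_key (cell_vertex s1 s2 s3 i) < sort_key (cell_vertex s1 s2 s3 j) ->
  0 < height y \/ y = axis.
Proof.
rewrite {}/y heightB !sort_key_cell_vertex !height_cell_vertex.
case: i j => [[|[|[|[|[|//]]]]] i5] [[|[|[|[|[|//]]]]] j5] //=;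
  rewrite ?(subr0 axis); case: s1 => //; case: s2 => //; case: s3 => //;
  by [left|right].
Qed.

(** The symmetry about the midpoint of the diagonal swaps its ends and flips every sign. *)
Lemma cell_vertex_opp s1 s2 s3 i : exists k,
  axis - cell_vertex s1 s2 s3 i = cell_vertex (~~ s1) (~~ s2) (~~ s3) k.
Proof.
case: i => [[|[|[|[|[|//]]]]] i5].
- by exists (@Ordinal 5 1 isT); rewrite /cell_vertex /= subr0.
- by exists (@Ordinal 5 0 isT); rewrite /cell_vertex /= subrr.
- exists (@Ordinal 5 2 isT); rewrite /cell_vertex /=.
  by case: s1; apply: vec4P; rewrite !mxE.
- exists (@Ordinal 5 3 isT); rewrite /cell_vertex /=.
  by case: s2; apply: vec4P; rewrite !mxE.
- exists (@Ordinal 5 4 isT); rewrite /cell_vertex /=.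
  by case: s3; apply: vec4P; rewrite !mxE.
Qed.

Lemma base_shift p v : base_simplices p -> base_simplices (fun i => p i + v).
Proof.
move=> [cp [t [z [s1 [s2 [s3 pz]]]]]]; split.
  by move=> i j ij; rewrite opprD addrACA subrr addr0; exact: cp.
exists t, (z + v), s1, s2, s3 => i; have [k ->] := pz i; exists k.
by rewrite addrAC.
Qed.

Lemma base_opp p : base_simplices p -> base_simplices (fun i => - p (rev_ord i)).
Proof.
move=> [cp [t [z [s1 [s2 [s3 pz]]]]]]; split.
  move=> i j ij; rewrite opprK addrC; apply: cp => /=.
  by have := ltn_ord j; lia.
(* The reflected diagonal has ends [- z - tau_pow t axis] and [- z]. *)
exists t, (- z - tau_pow t axis), (~~ s1), (~~ s2), (~~ s3) => i.
have [k ->] := pz (rev_ord i); have [l kl] := cell_vertex_opp s1 s2 s3 k.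
by exists l; rewrite -kl tau_powB addrA subrK opprD.
Qed.

Lemma base_simplex t z s1 s2 s3 : exists2 f : 'I_5 -> 'I_5, injective f &
  base_simplices (fun i => z + tau_pow t (cell_vertex s1 s2 s3 (f i))).
Proof.
have [f fI fk] := increasing_perm (@sort_key_inj s1 s2 s3).
exists f => //; split; last by exists t, z, s1, s2, s3 => i; exists (f i).
move=> i j /fk/sort_key_lt; rewrite opprD addrACA subrr add0r -tau_powB.
by case=> [h|->]; [left; rewrite height_tau_pow|right; exists t].
Qed.

Section BaseCover.
Variable R : realType.

(** Barycentric coordinates in the simplex of [in_cell], whose inequalities express their
    nonnegativity. *)
Definition cell_weight (s1 s2 s3 : bool) (a b1 b2 b3 : R) (i : 'I_5) : R :=
  nth 0 [:: 1 - (a + pos_part s1 b1 + pos_part s2 b2 + pos_part s3 b3);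
    a - (neg_part s1 b1 + neg_part s2 b2 + neg_part s3 b3);
    pos_part s1 b1 + neg_part s1 b1; pos_part s2 b2 + neg_part s2 b2;
    pos_part s3 b3 + neg_part s3 b3] i.

Lemma sum_ord5 (V : zmodType) (F : 'I_5 -> V) : \sum_i F i =
  F (@Ordinal 5 0 isT) + F (@Ordinal 5 1 isT) + F (@Ordinal 5 2 isT)
  + F (@Ordinal 5 3 isT) + F (@Ordinal 5 4 isT).
Proof.
rewrite !big_ord_recl big_ord0 addr0 !addrA.
by congr (F _ + F _ + F _ + F _ + F _); exact: val_inj.
Qed.

Lemma cell_weight_weights s1 s2 s3 a b1 b2 b3 :
  in_cell s1 s2 s3 a b1 b2 b3 -> weights (cell_weight s1 s2 s3 a b1 b2 b3).
Proof.
move=> [H1 H2 H3 H4 H5]; split; last first.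
  by rewrite sum_ord5 /cell_weight /=; ring.
move=> [[|[|[|[|[|//]]]]] i5]; rewrite /cell_weight /=.
- by rewrite subr_ge0.
- by rewrite subr_ge0.
- exact: H1.
- exact: H2.
- exact: H3.
Qed.

Lemma cell_weight_sum s1 s2 s3 a b1 b2 b3 (w := cell_weight s1 s2 s3 a b1 b2 b3)
    (v := cell_vertex s1 s2 s3) :
  [/\ \sum_i w i * (c0 (v i))%:~R = a, \sum_i w i * (c1 (v i))%:~R = b1,
      \sum_i w i * (c2 (v i))%:~R = b2 & \sum_i w i * (c3 (v i))%:~R = b3].
Proof.
rewrite {}/v {}/w.
have C i := cell_vertexE s1 s2 s3 i.
have e0 i := let: And4 h _ _ _ := C i in h.
have e1 i := let: And4 _ h _ _ := C i in h.
have e2 i := let: And4 _ _ h _ := C i in h.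
have e3 i := let: And4 _ _ _ h := C i in h.
split.
- under eq_bigr do rewrite e0.
  rewrite sum_ord5 /cell_weight /pos_part /neg_part /=.
  by case: s1 {C e0 e1 e2 e3}; case: s2; case: s3 => /=; ring.
- under eq_bigr do rewrite e1.
  rewrite sum_ord5 /cell_weight /pos_part /neg_part /=.
  by case: s1 {C e0 e1 e2 e3} => /=; ring.
- under eq_bigr do rewrite e2.
  rewrite sum_ord5 /cell_weight /pos_part /neg_part /=.
  by case: s2 {C e0 e1 e2 e3} => /=; ring.
- under eq_bigr do rewrite e3.
  rewrite sum_ord5 /cell_weight /pos_part /neg_part /=.
  by case: s3 {C e0 e1 e2 e3} => /=; ring.
Qed.

Lemma in_cell_sum s1 s2 s3 a b1 b2 b3 (v := cell_vertex s1 s2 s3) :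
  in_cell s1 s2 s3 a b1 b2 b3 -> exists2 u : 'I_5 -> R, weights u &
  [/\ \sum_i u i * (c0 (v i))%:~R = a, \sum_i u i * (c1 (v i))%:~R = b1,
      \sum_i u i * (c2 (v i))%:~R = b2 & \sum_i u i * (c3 (v i))%:~R = b3].
Proof.
move=> H; exists (cell_weight s1 s2 s3 a b1 b2 b3).
  exact: cell_weight_weights.
exact: cell_weight_sum.
Qed.

Lemma tau_sum (I : finType) (u : I -> R) (v : I -> 'rV[int]_4) y0 y1 y2 y3 :
  [/\ \sum_i u i * (c0 (v i))%:~R = y0, \sum_i u i * (c1 (v i))%:~R = y1,
      \sum_i u i * (c2 (v i))%:~R = y2 & \sum_i u i * (c3 (v i))%:~R = y3] ->
  [/\ \sum_i u i * (c0 (tau (v i)))%:~R = - y0 - y0 - y1 - y2 - y3,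
      \sum_i u i * (c1 (tau (v i)))%:~R = y0 + y1,
      \sum_i u i * (c2 (tau (v i)))%:~R = y0 + y2
    & \sum_i u i * (c3 (tau (v i)))%:~R = y0 + y3].
Proof.
move=> [<- <- <- <-]; split.
- rewrite -!sumrN -!big_split; apply: eq_bigr => i _.
  by have [-> _ _ _] := tauE (v i); rewrite /= !(intrD, mulrNz); ring.
- rewrite -!big_split; apply: eq_bigr => i _.
  by have [_ -> _ _] := tauE (v i); rewrite /= intrD mulrDr.
- rewrite -!big_split; apply: eq_bigr => i _.
  by have [_ _ -> _] := tauE (v i); rewrite /= intrD mulrDr.
- rewrite -!big_split; apply: eq_bigr => i _.
  by have [_ _ _ ->] := tauE (v i); rewrite /= intrD mulrDr.
Qed.

Lemma class_cell_barycenter t s1 s2 s3 (x : 'rV[R]_4) (z : 'rV[int]_4) :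
  in_class_cell t s1 s2 s3 (c0 x - (c0 z)%:~R) (c1 x - (c1 z)%:~R)
    (c2 x - (c2 z)%:~R) (c3 x - (c3 z)%:~R) ->
  exists2 u, weights u &
    x = barycenter u (fun i => z + tau_pow t (cell_vertex s1 s2 s3 i)).
Proof.
have coord u k : weights u ->
    barycenter u (fun i => z + tau_pow t (cell_vertex s1 s2 s3 i)) 0 k =
    (z 0 k)%:~R + \sum_i u i * (tau_pow t (cell_vertex s1 s2 s3 i) 0 k)%:~R.
  move=> [_ u1]; rewrite summxE.
  have -> : (z 0 k)%:~R = \sum_i u i * (z 0 k)%:~R by rewrite -mulr_suml u1 mul1r.
  rewrite -big_split; apply: eq_bigr => i _.
  by rewrite !mxE intrD mulrDr.
case: t coord => [|[|t]] coord /= /in_cell_sum[u wu S]; exists u => //.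
- case: S => S0 S1 S2 S3.
  by apply: vec4P; rewrite coord//= ?S0 ?S1 ?S2 ?S3; ring.
- have [S0 S1 S2 S3] := tau_sum S.
  apply: vec4P; rewrite coord//= ?S0 ?S1 ?S2 ?S3; clear;
  move: (c0 x) (c1 x) (c2 x) (c3 x) => *; ring.
- have [S0 S1 S2 S3] := tau_sum (tau_sum S).
  apply: vec4P; rewrite coord//= ?S0 ?S1 ?S2 ?S3; clear;
  move: (c0 x) (c1 x) (c2 x) (c3 x) => *; ring.
Qed.

Lemma base_cover (x : 'rV[R]_4) : exists p u,
  [/\ base_simplices p, weights u & x = barycenter u p].
Proof.
have [t [z0 [z1 [z2 [z3 [s1 [s2 [s3 H]]]]]]]] := cell_cover (c0 x) (c1 x) (c2 x) (c3 x).
pose z := vec4 z0 z1 z2 z3.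
have [w [w0 w1] xw] : exists2 u, weights u &
    x = barycenter u (fun i => z + tau_pow t (cell_vertex s1 s2 s3 i)).
  by apply: class_cell_barycenter; rewrite !mxE.
have [f fI Sf] := base_simplex t z s1 s2 s3.
exists (fun i => z + tau_pow t (cell_vertex s1 s2 s3 (f i))), (w \o f); split.
- exact: Sf.
- by split=> [i|]; [exact: w0|rewrite -w1 [RHS](reindex_inj fI)].
- by rewrite xw /barycenter (reindex_inj fI).
Qed.

End BaseCover.

(** * Uniqueness of barycentric coordinates *)

Definition affine (F : 'rV[int]_4 -> int) : Prop :=
  exists c e0 e1 e2 e3, forall v,
    F v = c + e0 * c0 v + e1 * c1 v + e2 * c2 v + e3 * c3 v.

Lemma affine_tau_inv F t z : affine F -> affine (fun v => F (tau_inv t (v - z))).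
Proof.
move=> [c [e0 [e1 [e2 [e3 FE]]]]].
have affB G : affine G -> affine (fun v => G (v - z)).
  move=> [d [f0 [f1 [f2 [f3 GE]]]]].
  exists (d - f0 * c0 z - f1 * c1 z - f2 * c2 z - f3 * c3 z), f0, f1, f2, f3 => v.
  rewrite GE !mxE; move: (c0 v) (c1 v) (c2 v) (c3 v) (c0 z) (c1 z) (c2 z) (c3 z).
  by move=> *; ring.
have afft G : affine G -> affine (G \o tau).
  move=> [d [f0 [f1 [f2 [f3 GE]]]]].
  exists d, (f1 + f2 + f3 - f0 - f0), (f1 - f0), (f2 - f0), (f3 - f0) => v.
  rewrite /= GE; have [-> -> -> ->] := tauE v.
  by move: (c0 v) (c1 v) (c2 v) (c3 v) => *; ring.
apply: (affB (F \o tau_inv t)); have aF : affine F by exists c, e0, e1, e2, e3.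
by case: t => [|[|t]]; [exact: aF|exact: afft (afft _ aF)|exact: afft].
Qed.

Section AffineSums.
Variable R : realType.
Implicit Types F : 'rV[int]_4 -> int.

Lemma affine_sum F (I I' : finType) (u : I -> R) (u' : I' -> R) p p' :
  affine F -> weights u -> weights u' -> barycenter u p = barycenter u' p' ->
  \sum_i u i * (F (p i))%:~R = \sum_i u' i * (F (p' i))%:~R.
Proof.
move=> [c [e0 [e1 [e2 [e3 FE]]]]] [_ u1] [_ u'1] /rowP bp.
have H (J : finType) (w : J -> R) (q : J -> 'rV[int]_4) : \sum_j w j = 1 ->
    \sum_j w j * (F (q j))%:~R = c%:~R + e0%:~R * c0 (barycenter w q)
    + e1%:~R * c1 (barycenter w q) + e2%:~R * c2 (barycenter w q)
    + e3%:~R * c3 (barycenter w q).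
  move=> w1; have -> : c%:~R = \sum_j w j * c%:~R by rewrite -mulr_suml w1 mul1r.
  rewrite !summxE !mulr_sumr -!big_split; apply: eq_bigr => j _.
  by rewrite FE !mxE /= !(intrD, intrM); ring.
by rewrite !H// !bp.
Qed.

(* Two convex combinations of lattice points with the same value see the same
   sum of [psi - psi'], since both functions are [k] plus an affine one. *)
Lemma certificate (k psi psi' : 'rV[int]_4 -> int) (I I' : finType)
    (u : I -> R) (u' : I' -> R) p p' :
  affine (fun v => psi v - k v) -> affine (fun v => psi' v - k v) ->
  weights u -> weights u' -> barycenter u p = barycenter u' p' ->
  (forall i, u i != 0 -> psi (p i) = 0) ->
  (forall j, u' j != 0 -> psi' (p' j) = 0) ->
  (forall i, u i != 0 -> 0 <= psi' (p i)) ->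
  (forall j, u' j != 0 -> 0 <= psi (p' j)) ->
  forall j, u' j != 0 -> psi (p' j) = 0.
Proof.
move=> a a' wu wu' bp z z' g g'.
have E := affine_sum a wu wu' bp; have E' := affine_sum a' wu wu' bp.
(* With K and K' the sums of [k] under [u] and [u'], the two identities give K - K' for the sum of
   [psi'] and K' - K for that of [psi]. *)
have S : \sum_i u i * (psi' (p i))%:~R + \sum_j u' j * (psi (p' j))%:~R = 0.
  have split4 (J : finType) (w : J -> R) (q : J -> 'rV[int]_4) (f : 'rV[int]_4 -> int) :
      \sum_i w i * (f (q i) - k (q i))%:~R =
      \sum_i w i * (f (q i))%:~R - \sum_i w i * (k (q i))%:~R.
    by rewrite -sumrB; apply: eq_bigr => i _; rewrite intrD mulrNz mulrBr.
  move: E E'; rewrite !split4.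
  rewrite [\sum_i u i * (psi (p i))%:~R]big1 => [|i _]; last first.
    by have [->|/z ->] := eqVneq (u i) 0; rewrite ?mul0r ?mulr0.
  rewrite [\sum_i u' i * (psi' (p' i))%:~R]big1 => [|i _]; last first.
    by have [->|/z' ->] := eqVneq (u' i) 0; rewrite ?mul0r ?mulr0.
  move: (\sum_i _) (\sum_i _) (\sum_i _) (\sum_i _) => A B C D *; lra.
have ge0 i : 0 <= u i * (psi' (p i))%:~R.
  have [->|/g gi] := eqVneq (u i) 0; first by rewrite mul0r.
  by rewrite mulr_ge0 ?ler0z ?wu.1.
have ge0' j : 0 <= u' j * (psi (p' j))%:~R.
  have [->|/g' gj] := eqVneq (u' j) 0; first by rewrite mul0r.
  by rewrite mulr_ge0 ?ler0z ?wu'.1.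
move: S => /eqP; rewrite paddr_eq0 ?sumr_ge0// => /andP[_].
rewrite psumr_eq0// => /allP S j uj; have := S j (mem_index_enum _).
by rewrite mulf_eq0 (negPf uj)/= intr_eq0 => /eqP.
Qed.

End AffineSums.

(** * Forms that separate cells and simplices *)

Definition norm_form (y : 'rV[int]_4) : int :=
  (c0 y + c1 y) ^+ 2 + (c0 y + c2 y) ^+ 2 + (c0 y + c3 y) ^+ 2
  + (c0 y + c1 y + c2 y + c3 y) ^+ 2.

(* Nonnegative on the lattice; its zeros are the vertices of a cross-polytope. *)
Definition cell_form (y : 'rV[int]_4) : int :=
  norm_form y - (c0 y + c0 y + c0 y + c0 y + c1 y + c1 y + c2 y + c2 y + c3 y + c3 y).

(** A [tau]-invariant form vanishing on the plane of the cut diagonals. It separates the simplices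
    of one cross-polytope, as [norm_form] separates the cross-polytopes. *)
Definition split_form (y : 'rV[int]_4) : int :=
  (c1 y - c2 y) ^+ 2 + (c1 y - c3 y) ^+ 2 + (c2 y - c3 y) ^+ 2.

Definition cell_split_form (s1 s2 s3 : bool) (y : 'rV[int]_4) : int :=
  split_form y - 2 * ((-1) ^+ (~~ s1) * c1 y + (-1) ^+ (~~ s2) * c2 y + (-1) ^+ (~~ s3) * c3 y).

Lemma norm_form_tau y : norm_form (tau y) = norm_form y.
Proof.
rewrite /norm_form; have [-> -> -> ->] := tauE y.
by move: (c0 y) (c1 y) (c2 y) (c3 y) => *; ring.
Qed.

Lemma split_form_tau y : split_form (tau y) = split_form y.
Proof.
rewrite /split_form; have [_ -> -> ->] := tauE y.
by move: (c0 y) (c1 y) (c2 y) (c3 y) => *; ring.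
Qed.

Lemma norm_form_tau_inv t y : norm_form (tau_inv t y) = norm_form y.
Proof. by case: t => [|[|t]] //=; rewrite !norm_form_tau. Qed.

Lemma split_form_tau_inv t y : split_form (tau_inv t y) = split_form y.
Proof. by case: t => [|[|t]] //=; rewrite !split_form_tau. Qed.

Lemma affineD F G : affine F -> affine G -> affine (fun v => F v + G v).
Proof.
move=> [c [e0 [e1 [e2 [e3 FE]]]]] [d [f0 [f1 [f2 [f3 GE]]]]].
exists (c + d), (e0 + f0), (e1 + f1), (e2 + f2), (e3 + f3) => v.
by rewrite FE GE; move: (c0 v) (c1 v) (c2 v) (c3 v) => *; ring.
Qed.

(** Invariance under [tau] makes the quadratic parts cancel for every class, so cells of different
    classes are compared through one form. *)
Lemma affine_cell_form t z :
  affine (fun v => cell_form (tau_inv t (v - z)) - norm_form v).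
Proof.
have -> : (fun v => cell_form (tau_inv t (v - z)) - norm_form v) =
    fun v => (cell_form (tau_inv t (v - z)) - norm_form (tau_inv t (v - z)))
             + (norm_form (v - z) - norm_form v).
  by apply/funext => v; rewrite norm_form_tau_inv; ring.
apply: affineD.
  apply: (affine_tau_inv (F := fun y => cell_form y - norm_form y)).
  exists 0, (-4), (-2), (-2), (-2) => v; rewrite /cell_form.
  by move: (norm_form v) (c0 v) (c1 v) (c2 v) (c3 v) => *; ring.
pose s := c0 z + c1 z + c2 z + c3 z.
exists (norm_form z), (-2 * (c0 z + c1 z + c0 z + c2 z + c0 z + c3 z + s)),
  (-2 * (c0 z + c1 z + s)), (-2 * (c0 z + c2 z + s)), (-2 * (c0 z + c3 z + s)) => v.
rewrite /norm_form /s !mxE.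
move: (c0 v) (c1 v) (c2 v) (c3 v) (c0 z) (c1 z) (c2 z) (c3 z) => *; ring.
Qed.

Lemma affine_cell_split_form t z s1 s2 s3 :
  affine (fun v => cell_split_form s1 s2 s3 (tau_inv t (v - z)) - split_form v).
Proof.
have -> : (fun v => cell_split_form s1 s2 s3 (tau_inv t (v - z)) - split_form v) =
    fun v => (cell_split_form s1 s2 s3 (tau_inv t (v - z))
              - split_form (tau_inv t (v - z)))
             + (split_form (v - z) - split_form v).
  by apply/funext => v; rewrite split_form_tau_inv; ring.
apply: affineD.
  apply: (affine_tau_inv (F := fun y => cell_split_form s1 s2 s3 y - split_form y)).
  exists 0, 0, (-2 * (-1) ^+ ~~ s1), (-2 * (-1) ^+ ~~ s2), (-2 * (-1) ^+ ~~ s3) => v.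
  rewrite /cell_split_form.
  move: (split_form v) ((-1) ^+ ~~ s1) ((-1) ^+ ~~ s2) ((-1) ^+ ~~ s3).
  by move: (c0 v) (c1 v) (c2 v) (c3 v) => *; ring.
pose s := c1 z + c2 z + c3 z.
exists (split_form z), 0, (-2 * (3 * c1 z - s)), (-2 * (3 * c2 z - s)),
  (-2 * (3 * c3 z - s)) => v.
rewrite /split_form /s !mxE.
move: (c0 v) (c1 v) (c2 v) (c3 v) (c0 z) (c1 z) (c2 z) (c3 z) => *; ring.
Qed.

Lemma binom_int_ge0 (w : int) : 0 <= w * (w - 1).
Proof. nia. Qed.

Lemma cell_formE (y : 'rV[int]_4) (w1 := c0 y + c1 y) (w2 := c0 y + c2 y) (w3 := c0 y + c3 y)
    (w4 := c0 y + c1 y + c2 y + c3 y) :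
  cell_form y = w1 * (w1 - 1) + w2 * (w2 - 1) + w3 * (w3 - 1) + w4 * (w4 - 1).
Proof.
rewrite /cell_form /norm_form /w1 /w2 /w3 /w4.
by move: (c0 y) (c1 y) (c2 y) (c3 y) => *; ring.
Qed.

Lemma cell_form_ge0 y : 0 <= cell_form y.
Proof. by rewrite cell_formE !addr_ge0// binom_int_ge0. Qed.

(** The four linear functions of [cell_formE] are 0 or 1. The first three minus the fourth give an
    even number, which excludes 8 of the 16 cases; the others are the vertices. *)
Lemma cell_form_eq0 y : cell_form y = 0 ->
  exists s1 s2 s3 k, y = cell_vertex s1 s2 s3 k.
Proof.
rewrite cell_formE => S.
have V s1 s2 s3 (k : 'I_5) : c0 y = nth 0 [:: 0; 1; (~~ s1)%:R; (~~ s2)%:R; (~~ s3)%:R] k ->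
    c1 y = nth 0 [:: 0; 0; (-1) ^+ ~~ s1; 0; 0] k ->
    c2 y = nth 0 [:: 0; 0; 0; (-1) ^+ ~~ s2; 0] k ->
    c3 y = nth 0 [:: 0; 0; 0; 0; (-1) ^+ ~~ s3] k ->
    exists s1 s2 s3 k, y = cell_vertex s1 s2 s3 k.
  move=> e0 e1 e2 e3; exists s1, s2, s3, k.
  by have [f0 f1 f2 f3] := cell_vertexE s1 s2 s3 k; apply: vec4P; rewrite ?f0 ?f1 ?f2 ?f3.
have V0 := V true true true (@Ordinal 5 0 isT); have V1 := V true true true (@Ordinal 5 1 isT).
have V2 := V true true true (@Ordinal 5 2 isT); have V3 := V true true true (@Ordinal 5 3 isT).
have V4 := V true true true (@Ordinal 5 4 isT); have V5 := V false true true (@Ordinal 5 2 isT).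
have V6 := V true false true (@Ordinal 5 3 isT); have V7 := V true true false (@Ordinal 5 4 isT).
move: S {V} V0 V1 V2 V3 V4 V5 V6 V7; rewrite /= expr0 expr1.
set goal := (exists _, _); move: goal => goal.
move: (c0 y) (c1 y) (c2 y) (c3 y) => a b1 b2 b3 S.
have b (w : int) : w * (w - 1) = 0 -> w = 0 \/ w = 1 by nia.
have g1 := binom_int_ge0 (a + b1); have g2 := binom_int_ge0 (a + b2).
have g3 := binom_int_ge0 (a + b3); have g4 := binom_int_ge0 (a + b1 + b2 + b3).
have /b e1 : (a + b1) * (a + b1 - 1) = 0.
  by move: (_ * _) (_ * _) (_ * _) (_ * _) g1 g2 g3 g4 S; clear; lia.
have /b e2 : (a + b2) * (a + b2 - 1) = 0.
  by move: (_ * _) (_ * _) (_ * _) (_ * _) g1 g2 g3 g4 S; clear; lia.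
have /b e3 : (a + b3) * (a + b3 - 1) = 0.
  by move: (_ * _) (_ * _) (_ * _) (_ * _) g1 g2 g3 g4 S; clear; lia.
have /b e4 : (a + b1 + b2 + b3) * (a + b1 + b2 + b3 - 1) = 0.
  by move: (_ * _) (_ * _) (_ * _) (_ * _) g1 g2 g3 g4 S; clear; lia.
clear -e1 e2 e3 e4; move=> V0 V1 V2 V3 V4 V5 V6 V7.
case: e1 => e1; case: e2 => e2; case: e3 => e3; case: e4 => e4;
  [apply: V0|exfalso|exfalso|apply: V4|exfalso|apply: V3|apply: V5|exfalso|
   exfalso|apply: V2|apply: V6|exfalso|apply: V7|exfalso|exfalso|apply: V1];
  clear -e1 e2 e3 e4; lia.
Qed.

Lemma cell_split_form_vertex s1 s2 s3 r1 r2 r3 k (y := cell_vertex r1 r2 r3 k) :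
  0 <= cell_split_form s1 s2 s3 y /\
  (cell_split_form s1 s2 s3 y = 0 -> y = cell_vertex s1 s2 s3 k).
Proof.
rewrite {}/y /cell_split_form /split_form.
have [_ -> -> ->] := cell_vertexE r1 r2 r3 k.
rewrite /cell_vertex; case: k => [[|[|[|[|[|//]]]]] k5] /=.
- by case: s1; case: s2; case: s3.
- by case: s1; case: s2; case: s3.
- by case: s1; case: r1; case: s2; case: s3.
- by case: s2; case: r2; case: s1; case: s3.
- by case: s3; case: r3; case: s1; case: s2.
Qed.

Lemma cell_form_vertex s1 s2 s3 k : cell_form (cell_vertex s1 s2 s3 k) = 0.
Proof.
rewrite cell_formE; have [-> -> -> ->] := cell_vertexE s1 s2 s3 k.
by case: k => [[|[|[|[|[|//]]]]] k5] /=; [|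
  |case: s1|case: s2|case: s3].
Qed.

Lemma cell_split_form_vertex0 s1 s2 s3 k :
  cell_split_form s1 s2 s3 (cell_vertex s1 s2 s3 k) = 0.
Proof.
rewrite /cell_split_form /split_form; have [_ -> -> ->] := cell_vertexE s1 s2 s3 k.
by case: k => [[|[|[|[|[|//]]]]] k5] /=; case: s1; case: s2; case: s3.
Qed.

(** The simplex is unimodular, so its barycentric coordinates have integer coefficients. *)
Lemma affine_indicator s1 s2 s3 k : exists2 F, affine F &
  forall l, F (cell_vertex s1 s2 s3 l) = (l == k)%:R.
Proof.
have aff c e0 e1 e2 e3 (F := fun v : 'rV[int]_4 =>
    c + e0 * c0 v + e1 * c1 v + e2 * c2 v + e3 * c3 v) :
    (forall l, F (cell_vertex s1 s2 s3 l) = (l == k)%:R) ->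
    exists2 F, affine F & forall l, F (cell_vertex s1 s2 s3 l) = (l == k)%:R.
  by move=> HF; exists F => //; exists c, e0, e1, e2, e3.
have E l := cell_vertexE s1 s2 s3 l.
case: k aff => [[|[|[|[|[|//]]]]] k5] aff.
- apply: (aff 1 (-1) (- s1%:R) (- s2%:R) (- s3%:R)) => l; have [-> -> -> ->] := E l.
  by case: l => [[|[|[|[|[|//]]]]] l5] /=; case: (s1); case: (s2); case: (s3).
- apply: (aff 0 1 (~~ s1)%:R (~~ s2)%:R (~~ s3)%:R) => l; have [-> -> -> ->] := E l.
  by case: l => [[|[|[|[|[|//]]]]] l5] /=; case: (s1); case: (s2); case: (s3).
- apply: (aff 0 0 ((-1) ^+ ~~ s1) 0 0) => l; have [-> -> -> ->] := E l.
  by case: l => [[|[|[|[|[|//]]]]] l5] /=; case: (s1); case: (s2); case: (s3).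
- apply: (aff 0 0 0 ((-1) ^+ ~~ s2) 0) => l; have [-> -> -> ->] := E l.
  by case: l => [[|[|[|[|[|//]]]]] l5] /=; case: (s1); case: (s2); case: (s3).
- apply: (aff 0 0 0 0 ((-1) ^+ ~~ s3)) => l; have [-> -> -> ->] := E l.
  by case: l => [[|[|[|[|[|//]]]]] l5] /=; case: (s1); case: (s2); case: (s3).
Qed.

Lemma cell_vertex_inj s1 s2 s3 : injective (cell_vertex s1 s2 s3).
Proof. by move=> i j ij; apply: (@sort_key_inj s1 s2 s3); rewrite ij. Qed.

(** The first form puts the vertices of nonzero weight of each simplex into the cross-polytope of
    the other, where the second form is nonnegative. The second form then puts those of [p'] into
    the simplex of [p], whose barycentric coordinates give the masses. *)
Lemma base_uniq (R : realType) p p' (u u' : 'I_5 -> R) :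
  base_simplices p -> base_simplices p' -> weights u -> weights u' ->
  barycenter u p = barycenter u' p' -> mass u p =1 mass u' p'.
Proof.
move=> [_ [t [z [s1 [s2 [s3 pz]]]]]] [_ [t' [z' [r1 [r2 [r3 pz']]]]]] wu wu' bp.
have loc i : exists k, tau_inv t (p i - z) = cell_vertex s1 s2 s3 k.
  by have [k ->] := pz i; exists k; rewrite addrAC subrr add0r tau_powK.
have loc' i : exists k, tau_inv t' (p' i - z') = cell_vertex r1 r2 r3 k.
  by have [k ->] := pz' i; exists k; rewrite addrAC subrr add0r tau_powK.
have C' j : u' j != 0 -> cell_form (tau_inv t (p' j - z)) = 0.
  apply: (certificate (k := norm_form) (psi := fun v => cell_form (tau_inv t (v - z)))
    (psi' := fun v => cell_form (tau_inv t' (v - z'))) _ _ wu wu' bp);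
    try exact: affine_cell_form; move=> i _.
  - by have [k ->] := loc i; exact: cell_form_vertex.
  - by have [k ->] := loc' i; exact: cell_form_vertex.
  - exact: cell_form_ge0.
  - exact: cell_form_ge0.
have C i : u i != 0 -> cell_form (tau_inv t' (p i - z')) = 0.
  apply: (certificate (k := norm_form) (psi := fun v => cell_form (tau_inv t' (v - z')))
    (psi' := fun v => cell_form (tau_inv t (v - z))) _ _ wu' wu (esym bp));
    try exact: affine_cell_form; move=> j _.
  - by have [k ->] := loc' j; exact: cell_form_vertex.
  - by have [k ->] := loc j; exact: cell_form_vertex.
  - exact: cell_form_ge0.
  - exact: cell_form_ge0.
have D j : u' j != 0 -> cell_split_form s1 s2 s3 (tau_inv t (p' j - z)) = 0.
  apply: (certificate (k := split_form)
    (psi := fun v => cell_split_form s1 s2 s3 (tau_inv t (v - z)))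
    (psi' := fun v => cell_split_form r1 r2 r3 (tau_inv t' (v - z'))) _ _ wu wu' bp);
    try exact: affine_cell_split_form; move=> i ui.
  - by have [k ->] := loc i; exact: cell_split_form_vertex0.
  - by have [k ->] := loc' i; exact: cell_split_form_vertex0.
  - have [q1 [q2 [q3 [k ->]]]] := cell_form_eq0 (C i ui).
    by have [] := cell_split_form_vertex r1 r2 r3 q1 q2 q3 k.
  - have [q1 [q2 [q3 [k ->]]]] := cell_form_eq0 (C' i ui).
    by have [] := cell_split_form_vertex s1 s2 s3 q1 q2 q3 k.
have loc'' j : u' j != 0 -> exists k, tau_inv t (p' j - z) = cell_vertex s1 s2 s3 k.
  move=> uj; have [q1 [q2 [q3 [k E]]]] := cell_form_eq0 (C' j uj).
  have [_ H] := cell_split_form_vertex s1 s2 s3 q1 q2 q3 k.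
  by exists k; rewrite E H// -E; exact: D.
have E (q : 'I_5 -> 'rV[int]_4) j k : tau_inv t (q j - z) = cell_vertex s1 s2 s3 k ->
    q j = z + tau_pow t (cell_vertex s1 s2 s3 k).
  by move=> <-; rewrite tau_invK addrC subrK.
have massE (q : 'I_5 -> 'rV[int]_4) (w : 'I_5 -> R) k F :
    (forall j, w j != 0 -> exists k, tau_inv t (q j - z) = cell_vertex s1 s2 s3 k) ->
    (forall l, F (cell_vertex s1 s2 s3 l) = (l == k)%:R) ->
    mass w q (z + tau_pow t (cell_vertex s1 s2 s3 k)) =
    \sum_j w j * (F (tau_inv t (q j - z)))%:~R.
  move=> wq Fk; rewrite /mass big_mkcond; apply: eq_bigr => j _.
  have [->|/wq[l ql]] := eqVneq (w j) 0; first by rewrite mul0r if_same.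
  rewrite ql Fk (E _ _ _ ql) (inj_eq (addrI z)) (inj_eq (can_inj (tau_powK t))).
  rewrite (inj_eq (@cell_vertex_inj s1 s2 s3)).
  by case: eqP => _; rewrite ?mulr1 ?mulr0.
move=> v; have [[k vk]|nk] := pselect (exists k, v = z + tau_pow t (cell_vertex s1 s2 s3 k)).
  have [F aF Fk] := affine_indicator s1 s2 s3 k.
  rewrite vk (massE _ _ _ F)// (massE _ _ _ F)//.
  exact: (affine_sum (affine_tau_inv t z aF) wu wu' bp).
have m0 (q : 'I_5 -> 'rV[int]_4) (w : 'I_5 -> R) :
    (forall j, w j != 0 -> exists k, tau_inv t (q j - z) = cell_vertex s1 s2 s3 k) ->
    mass w q v = 0.
  move=> wq; apply/eqP; apply: contrapT => /negP/mass_neq0[j qj /wq[k /E qk]].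
  by apply: nk; exists k; rewrite -qj.
by rewrite !m0.
Qed.

Theorem base_triangulation (R : realType) :
  ordered_triangulation R base_simplices base_order.
Proof.
split.
- by move=> p [+ _].
- exact: base_order_asym.
- exact: base_shift.
- exact: base_opp.
- exact: base_cover.
- exact: base_uniq.
Qed.

(** * Skew diagonals and Delaunay tessellations *)

Section SkewEdges.
Variables (m : nat) (Sg : set ('I_m.+1 -> 'rV[int]_m)) (P : set 'rV[int]_m).

(* If [d t - e] is not comparable to 0, then no simplex contains the four
   vertices of a parallelogram with sides [d t] and [e]. *)
Definition skew_diagonals : Prop := exists (e : 'rV[int]_m) (d : 'I_3 -> 'rV[int]_m),
  \sum_t d t = 0 /\ forall t, [/\ d t <> e, ~ P (d t - e), ~ P (e - d t)
    & exists2 p, Sg p & exists i j, p j - p i = d t + e].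

End SkewEdges.

Section SkewPrism.
Variables (m : nat) (Sg : set ('I_m.+1 -> 'rV[int]_m)) (P : set 'rV[int]_m).

Lemma staircase_low p k (i l : 'I_m.+1) : (l <= i)%N ->
  exists j, staircase p k i j = row_cons k (p l).
Proof.
rewrite leq_eqVlt => /orP[/eqP/val_inj ->|li].
  by exists (widen_ord (leqnSn _) i); rewrite /staircase unlift_none.
exists (lift (widen_ord (leqnSn _) i) l).
by rewrite /staircase liftK leqNgt li addr0.
Qed.

Lemma staircase_high p k (i l : 'I_m.+1) : (i <= l)%N ->
  exists j, staircase p k i j = row_cons (k + 1) (p l).
Proof.
move=> il; exists (lift (widen_ord (leqnSn _) i) l).
by rewrite /staircase liftK il.
Qed.

Lemma row_consB (c c' : int) (v v' : 'rV[int]_m) :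
  row_cons c v - row_cons c' v' = row_cons (c - c') (v - v').
Proof.
apply: row_consP; first by rewrite !mxE unlift_none.
by rewrite row_tailD row_tailN !row_consK.
Qed.

Lemma row_consD (c c' : int) (v v' : 'rV[int]_m) :
  row_cons c v + row_cons c' v' = row_cons (c + c') (v + v').
Proof.
apply: row_consP; first by rewrite !mxE unlift_none.
by rewrite row_tailD !row_consK.
Qed.

Lemma sum_row_cons0 (I : finType) (d : I -> 'rV[int]_m) :
  \sum_t d t = 0 -> \sum_t row_cons 0 (d t) = 0.
Proof.
move=> d0; apply/rowP => k; rewrite summxE mxE.
case: (unliftP ord0 k) => [j ->|->].
  under eq_bigr do rewrite mxE liftK.
  by have /rowP/(_ j) := d0; rewrite summxE mxE.
by rewrite big1// => t _; rewrite mxE unlift_none.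
Qed.

Variable R : realType.
Hypothesis otP : ordered_triangulation R Sg P.

Lemma skew_prism : skew_diagonals Sg P ->
  skew_diagonals (prism_simplices Sg P) (prism_order P).
Proof.
move=> [e [d [d0 de]]]; exists (row_cons 0 e), (fun t => row_cons 0 (d t)).
split=> [|t]; first exact: sum_row_cons0.
have [dte nP nP' [p Sp [i [j pij]]]] := de t.
split.
- by move=> /(congr1 row_tail); rewrite !row_consK.
- rewrite row_consB => -[_ + _]; rewrite row_consK.
  by case=> // /eqP; rewrite subr_eq0 => /eqP.
- rewrite row_consB => -[_ + _]; rewrite row_consK.
  by case=> // /eqP; rewrite subr_eq0 => /eqP /esym.
(* The last staircase contains the whole bottom copy of [p], hence the old diagonal at height 0. *)
- exists (staircase p 0 ord_max); first exact: (staircase_simplex otP).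
  have [i' ii'] := staircase_low p 0 (leq_ord i : (i <= @ord_max m)%N).
  have [j' jj'] := staircase_low p 0 (leq_ord j : (j <= @ord_max m)%N).
  by exists i', j'; rewrite ii' jj' row_consB row_consD pij.
Qed.

End SkewPrism.

(** With [e] vertical, [d t - e] ascends in the base and descends vertically, so it is not
    comparable to 0. The three diagonals ascend although their sum is 0. *)
Lemma base_skew_prism (R : realType) :
  skew_diagonals (prism_simplices base_simplices base_order) (prism_order base_order).
Proof.
exists (row_cons 1 0), (fun t : 'I_3 => row_cons 0 (tau_pow t axis)); split.
  apply: sum_row_cons0; rewrite !big_ord_recl big_ord0 /=.
  by rewrite tau2_axis tau_axis; apply: vec4P; rewrite !mxE.
move=> t.
have Pt : base_order (tau_pow t axis) by right; exists t.
split.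
- by move=> /matrixP/(_ 0 0); rewrite !row_cons0.
- by rewrite row_consB => -[_ _]; rewrite row_cons0.
- rewrite row_consB => -[_ + _]; rewrite row_consK sub0r.
  case=> [/eqP|]; last exact: base_order_asym Pt.
  rewrite oppr_eq0 => /eqP t0; have := base_order_asym Pt.
  by rewrite {1}t0 oppr0 -t0.
- have [f fI Sf] := base_simplex t 0 true true true.
  have [g _ fg] := injF_bij fI.
  pose p i := 0 + tau_pow t (cell_vertex true true true (f i)).
  have p0 : p (g (@Ordinal 5 0 isT)) = 0.
    rewrite /p fg add0r /cell_vertex /=; case: (nat_of_ord t) => [|[|k]] //=.
      by apply: vec4P; rewrite !mxE.
    have -> : tau 0 = 0 by apply: vec4P; rewrite !mxE.
    by apply: vec4P; rewrite !mxE.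
  have p1 : p (g (@Ordinal 5 1 isT)) = tau_pow t axis by rewrite /p fg add0r.
  have le : (g (@Ordinal 5 0 isT) <= g (@Ordinal 5 1 isT))%N.
    rewrite leqNgt; apply/negP => /(Sf.1).
    by rewrite -/(p _) -/(p _) p0 p1 sub0r; exact: base_order_asym Pt.
  (* As 0 precedes [tau_pow t axis], the staircase rising over 0 holds the bottom copy of 0 and the
     top copy of [tau_pow t axis]. *)
  exists (staircase p 0 (g (@Ordinal 5 0 isT))).
    exact: (staircase_simplex (base_triangulation R)).
  have [i ii] := staircase_low p 0 (leqnn (g (@Ordinal 5 0 isT))).
  have [j jj] := staircase_high p 0 le.
  by exists i, j; rewrite ii jj row_consB row_consD p0 p1 !subr0 addr0.
Qed.

(** * Positive definite forms and supporting hyperplanes *)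

Section QuadraticForms.
Variables (R : realType) (n : nat) (A : 'M[R]_n).
Hypothesis posA : positive_definite A.

Definition bilinear_form (x y : 'rV[R]_n) : R := (x *m A *m y^T) 0 0.

Lemma bilinear_formDl x x' y :
  bilinear_form (x + x') y = bilinear_form x y + bilinear_form x' y.
Proof. by rewrite /bilinear_form !mulmxDl mxE. Qed.

Lemma bilinear_formZl a x y : bilinear_form (a *: x) y = a * bilinear_form x y.
Proof. by rewrite /bilinear_form -!scalemxAl mxE. Qed.

Lemma bilinear_formC x y : bilinear_form x y = bilinear_form y x.
Proof.
have tr (M : 'M[R]_1) : M 0 0 = M^T 0 0 by rewrite mxE.
by rewrite /bilinear_form tr !trmx_mul trmxK posA.1 mulmxA.
Qed.

Lemma bilinear_formDr x y y' :
  bilinear_form x (y + y') = bilinear_form x y + bilinear_form x y'.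
Proof. by rewrite ![bilinear_form x _]bilinear_formC bilinear_formDl. Qed.

Lemma bilinear_formZr a x y : bilinear_form x (a *: y) = a * bilinear_form x y.
Proof. by rewrite ![bilinear_form x _]bilinear_formC bilinear_formZl. Qed.

Lemma quad_formE x : quad_form A x = bilinear_form x x.
Proof. by []. Qed.

Lemma quad_form_ge0 x : 0 <= quad_form A x.
Proof.
have [->|x0] := eqVneq x 0; last exact/ltW/posA.2.
by rewrite /quad_form !mul0mx mxE.
Qed.

Lemma quad_formN x : quad_form A (- x) = quad_form A x.
Proof. by rewrite /quad_form linearN /= mulmxN !mulNmx opprK. Qed.

(** The convexity defect is t (1 - t) times the form at the difference of the two points. *)
Lemma convex_epigraph :
  convex_set [set y : 'rV[R]_(n + 1) | quad_form A (lsubmx y) <= rsubmx y 0 0].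
Proof.
apply/convex_setP => t x y t0 t1 /= Hx Hy.
have -> : lsubmx (t *: x + (1 - t) *: y) = t *: lsubmx x + (1 - t) *: lsubmx y.
  by apply/rowP => k; rewrite !mxE.
have -> : rsubmx (t *: x + (1 - t) *: y) 0 0 =
    t * rsubmx x 0 0 + (1 - t) * rsubmx y 0 0 by rewrite !mxE.
have := quad_form_ge0 (lsubmx x + (-1) *: lsubmx y); move: Hx Hy.
rewrite !quad_formE !(bilinear_formDl, bilinear_formDr, bilinear_formZl, bilinear_formZr).
rewrite (bilinear_formC (lsubmx y) (lsubmx x)).
move: (bilinear_form _ _) (bilinear_form _ _) (bilinear_form _ _) (rsubmx x 0 0)
  (rsubmx y 0 0) => xy yy xx rx ry Hx Hy H.
have Ht : 0 <= t * (1 - t) by rewrite mulr_ge0 ?subr_ge0.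
have T : 0 <= t * (1 - t) * (xx + -1 * xy + (-1 * xy + -1 * (-1 * yy))).
  exact: mulr_ge0.
have Tx : t * xx <= t * rx by rewrite ler_wpM2l.
have Ty : (1 - t) * yy <= (1 - t) * ry by rewrite ler_wpM2l ?subr_ge0.
nra.
Qed.

Lemma le0_of_bounded_multiples (a c : R) : (forall k : nat, k%:R * a <= c) -> a <= 0.
Proof.
move=> H; rewrite leNgt; apply/negP => a0.
have c0 : 0 <= c by have := H 0%N; rewrite mul0r.
have := H (Num.truncn (c / a)).+1; rewrite leNgt -ltr_pdivrMr//.
by rewrite truncnS_gt.
Qed.

(* The hyperplane supporting the lifted lattice along a facet is not vertical,
   so it is the graph of an affine function. *)
Lemma delaunay_support S : delaunay_tessellation A S -> S !=set0 ->
  (exists v : 'rV[int]_n, v <> 0) ->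
  exists (l : 'cV[R]_n) (a c : R), 0 < a /\ forall v : 'rV[int]_n,
    let h := c - (real_point R v *m l) 0 0 + a * quad_form A (real_point R v) in
    0 <= h /\ (S (real_point R v) <-> h = 0).
Proof.
move=> [F [[l [c [Cl FE]]] [dim [dimC dimF]]] <-] [_ [y0 Fy0 _]] [w w0].
set C := convex_hull _ in Cl FE dimC.
have sc (b : R) : (b%:M : 'M[R]_1) 0 0 = b by rewrite mxE eqxx mulr1n.
pose lam : 'cV[R]_n := usubmx l; pose mu := dsubmx l 0 0.
have lE x : (x *m l) 0 0 = (lsubmx x *m lam) 0 0 + rsubmx x 0 0 * mu.
  rewrite -{1}[x]hsubmxK -{1}[l]vsubmxK mul_row_col mxE; congr (_ + _).
  by rewrite mxE big_ord1.
have liftE (v : 'rV[int]_n) : (lift_point A (real_point R v) *m l) 0 0 =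
    (real_point R v *m lam) 0 0 + quad_form A (real_point R v) * mu.
  by rewrite lE /lift_point row_mxKl row_mxKr sc.
have Clift (v : 'rV[int]_n) : C (lift_point A (real_point R v)).
  by move=> D [_]; apply; exists (real_point R v) => //=; apply/int_pointP; exists v.
have bound v : (real_point R v *m lam) 0 0 + quad_form A (real_point R v) * mu <= c.
  by rewrite -liftE; apply: Cl.
have boundN v (k : nat) : k%:R * (real_point R v *m lam) 0 0 +
    k%:R * (k%:R * (quad_form A (real_point R v) * mu)) <= c.
  have := bound (v *+ k).
  have -> : real_point R (v *+ k) = k%:R *: real_point R v.
    by apply/rowP => j; rewrite !mxE mulmxnE rmorphMn /= mulr_natl.
  by rewrite -scalemxAl mxE quad_formE bilinear_formZl bilinear_formZr -!mulrA.
have q0 : 0 < quad_form A (real_point R w).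
  apply: posA.2; apply/eqP => rw; apply: w0; apply: (@real_point_inj R).
  by rewrite rw; apply/rowP => j; rewrite !mxE.
(* The bounds at multiples of [w] and [- w] add up without linear term, which excludes [mu > 0]. If
   [mu = 0], boundedness kills [lam] too, and the facet would be the whole hull, against its
   dimension. *)
have mu0 : mu < 0.
  rewrite ltNge; apply/negP => mu_ge0.
  have mu_le0 : mu <= 0.
    rewrite -(pmulr_rle0 _ q0); apply: (@le0_of_bounded_multiples _ c) => k.
    have qm : 0 <= quad_form A (real_point R w) * mu by rewrite mulr_ge0// ltW.
    have := boundN w k; have := boundN (- w) k.
    rewrite real_pointN quad_formN mulNmx [(- (_ *m _)) 0 0]mxE mulrN.
    move: (k%:R * (_ *m _) 0 0) => L.
    have : k%:R * (quad_form A (real_point R w) * mu) <=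
        k%:R * (k%:R * (quad_form A (real_point R w) * mu)).
      case: k => [|k]; first by rewrite !mul0r.
      by apply: ler_peMl; rewrite ?ler1n ?(mulr_ge0 (ler0n _ _) qm).
    by move=> *; lra.
  have muE : mu = 0 by apply/eqP; rewrite eq_le mu_le0.
  have lam0 : lam = 0.
    have le0 v : (real_point R v *m lam) 0 0 <= 0.
      apply: (@le0_of_bounded_multiples _ c) => k.
      by have := boundN v k; rewrite muE !mulr0 addr0.
    apply/colP => k; rewrite [RHS]mxE.
    have dE : real_point R (delta_mx 0 k) *m lam = row k lam.
      by rewrite rowE; congr (_ *m _); apply/rowP => j; rewrite !mxE; case: (_ && _).
    apply/eqP; rewrite eq_le.
    have := le0 (delta_mx 0 k); rewrite dE mxE => ->.
    have := le0 (- delta_mx 0 k); rewrite real_pointN mulNmx dE !mxE.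
    by rewrite oppr_le0.
  have l0 x : (x *m l) 0 0 = 0 by rewrite lE lam0 muE mulmx0 mxE mulr0 addr0.
  have FC : F = C.
    have c0 : 0 = c by move: Fy0; rewrite FE => -[_ /=]; rewrite l0.
    by rewrite FE; apply/seteqP; split=> x; [case|split=> //=; rewrite l0].
  by apply: dimF.2; rewrite FC; exact: dimC.1.
exists lam, (- mu), c; split=> [|v h]; first by rewrite oppr_gt0.
have hE : h = c - (lift_point A (real_point R v) *m l) 0 0.
  by rewrite /h liftE; ring.
split; first by rewrite hE subr_ge0; apply: Cl.
split=> [[y Fy yv]|h0]; last first.
  exists (lift_point A (real_point R v)); last by rewrite /lift_point row_mxKl.
  rewrite FE; split=> //=; apply/esym/eqP; rewrite -subr_eq0 -hE.
  exact/eqP.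
move: Fy; rewrite FE => -[Cy /=]; rewrite lE yv => yl.
(* A facet point over [v] is not below the paraboloid; since [mu < 0], the lift of [v] then also
   attains the maximum [c]. *)
have yq : quad_form A (real_point R v) <= rsubmx y 0 0.
  rewrite -yv; apply: (Cy [set y | quad_form A (lsubmx y) <= rsubmx y 0 0]).
  split=> [|_ [x _ <-] /=]; first exact: convex_epigraph.
  by rewrite /lift_point row_mxKl row_mxKr sc.
apply/eqP; rewrite eq_le; apply/andP; split; last by rewrite hE subr_ge0; apply: Cl.
have := ler_wnM2r (ltW mu0) yq; rewrite /h -yl => *; lra.
Qed.

End QuadraticForms.

(** * Obstruction to being Delaunay *)

Section NotDelaunay.
Variables (R : realType) (m : nat) (Sg : set ('I_m.+1 -> 'rV[int]_m)) (P : set 'rV[int]_m).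
Hypothesis otP : ordered_triangulation R Sg P.

(** The supporting function vanishes at the ends of the diagonal, so its values at the other two
    corners of the parallelogram sum to -2 a A(d, e). If A(d, e) >= 0, these nonnegative values
    vanish, both corners are vertices of the simplex, and they would be comparable. *)
Lemma delaunay_diagonal (A : 'M[R]_m) p i j (d e : 'rV[int]_m) :
  positive_definite A -> simplices R Sg = delaunay_tessellation A ->
  Sg p -> p j - p i = d + e -> d <> e -> ~ P (d - e) -> ~ P (e - d) ->
  bilinear_form A (real_point R d) (real_point R e) < 0.
Proof.
move=> posA TA Sp pij de nP nP'; pose S := convex_hull (range (real_point R \o p)).
have TS : delaunay_tessellation A S by rewrite -TA; exists p.
have pS k : S (real_point R (p k)) by exact: (@convex_hull_vertex R m _ (real_point R \o p) k).
have v0 : exists v : 'rV[int]_m, v <> 0.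
  by exists (d - e); move/subr0_eq.
have [l [a [c [a0 H]]]] := delaunay_support posA TS (ex_intro _ _ (pS ord0)) v0.
have [_ [/(_ (pS i)) hi _]] := H (p i); have [_ [/(_ (pS j)) hj _]] := H (p j).
have [hd Sd] := H (p i + d); have [he Se] := H (p i + e).
have pj : p j = p i + d + e by rewrite -addrA -pij addrC subrK.
move: hi hj hd Sd he Se; rewrite pj !real_pointD !quad_formE.
rewrite !(bilinear_formDl, bilinear_formDr posA) !mulmxDl.
set x := real_point R (p i); set y := real_point R d; set z := real_point R e.
have mxD (M N : 'M[R]_1) : (M + N) 0 0 = M 0 0 + N 0 0 by rewrite mxE.
rewrite !mxD (bilinear_formC posA y x) (bilinear_formC posA z x) (bilinear_formC posA z y).
move: (bilinear_form A x x) (bilinear_form A x y) (bilinear_form A x z)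
  (bilinear_form A y y) (bilinear_form A z z) ((x *m l) 0 0) ((y *m l) 0 0) ((z *m l) 0 0)
  => xx xy xz yy zz xl yl zl.
set b := bilinear_form A y z => hi hj hd Sd he Se.
rewrite ltNge; apply/negP => b0.
have ab : 0 <= a * b by rewrite mulr_ge0// ltW.
have Sd' : S (x + y) by apply/Sd; lra.
have Se' : S (x + z) by apply/Se; lra.
rewrite /x /y /z -!real_pointD in Sd' Se'.
have [k1 _ pk1] := ot_int_point otP Sp Sd'; have [k2 _ pk2] := ot_int_point otP Sp Se'.
have [k12|k21|/val_inj k12] := ltngtP k1 k2.
- by have := ot_chain otP Sp k12; rewrite pk1 pk2 opprD addrACA subrr add0r.
- by have := ot_chain otP Sp k21; rewrite pk1 pk2 opprD addrACA subrr add0r.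
- by apply: de; apply: (addrI (p i)); rewrite -pk1 -pk2 k12.
Qed.

(** The three negative numbers A(d t, e) would sum to A(0, e) = 0. *)
Lemma skew_not_delaunay :
  skew_diagonals Sg P -> ~ delaunay_triangulation (simplices R Sg).
Proof.
move=> [e [d [d0 de]]] [_ [A [posA TA]]].
have neg t : bilinear_form A (real_point R (d t)) (real_point R e) < 0.
  have [dte nP nP' [p Sp [i [j pij]]]] := de t.
  exact: delaunay_diagonal posA TA Sp pij dte nP nP'.
have s0 : \sum_t bilinear_form A (real_point R (d t)) (real_point R e) = 0.
  move: d0; rewrite !big_ord_recl !big_ord0 !addr0 => d0.
  rewrite -!bilinear_formDl -!real_pointD d0.
  rewrite (_ : real_point R 0 = 0 *: 0); last by rewrite scale0r; apply/rowP => k; rewrite !mxE.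
  by rewrite bilinear_formZl mul0r.
move: s0; rewrite !big_ord_recl big_ord0.
have := neg ord0; have := neg (lift ord0 ord0); have := neg (lift ord0 (lift ord0 ord0)).
move: (bilinear_form _ _ _) (bilinear_form _ _ _) (bilinear_form _ _ _) => x y z.
by clear; lra.
Qed.

End NotDelaunay.

Unset Implicit Arguments.

Theorem theorem7p3 (R : realType) (n : nat) (hn : (5 <= n)%N) :
  exists T : set (set 'rV[R]_n),
    [/\ periodic_triangulation T,
        centrally_symmetric T
      & ~ delaunay_triangulation T].
Proof.
suff [Sg [P [otP sk]]] : exists (Sg : set ('I_n.+1 -> 'rV[int]_n)) (P : set 'rV[int]_n),
    ordered_triangulation R Sg P /\ skew_diagonals Sg P.
  exists (simplices R Sg); split.
  - exact: (ot_periodic_triangulation otP).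
  - exact: (ot_centrally_symmetric otP).
  - exact: (skew_not_delaunay otP).
(* Dimension 5 is the prism over the triangulation of Z^4; each further dimension is one more
   prism. *)
rewrite -(subnKC hn); elim: (n - 5)%N => [|k [Sg [P [otP sk]]]].
  exists (prism_simplices base_simplices base_order), (prism_order base_order).
  split; first exact: (prism_triangulation (base_triangulation R)).
  exact: (base_skew_prism R).
rewrite addnS; exists (prism_simplices Sg P), (prism_order P).
by split; [exact: prism_triangulation|exact: (skew_prism otP)].
Qed.
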